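(* Let $p$ be a prime with $p\equiv 1$ or $3\pmod 8$, and write $p=c^2+2d^2$ with $c,d\in\mathbb{Z}$ and $c\equiv 1\pmod 4$. Then $$\sum_{k=0}^{p-1}\frac{\binom{2k}{k}\binom{4k}{2k}}{128^k}\equiv (-1)^{\left[\frac p8\right]+\frac{p-1}{2}}\Bigl(2c-\frac{p}{2c}\Bigr)\pmod{p^2}.$$
   Context: $[y]$ denotes the greatest integer not exceeding $y$. Congruences modulo $p^2$ are taken in the ring $\mathbb{Z}_p$ of rational numbers whose denominator is coprime to $p$: for $u,v$ in this ring, $u\equiv v\pmod{p^2}$ means $(u-v)/p^2$ lies in this ring. *)

(* Defs.v *)
From mathcomp Require Import all_boot all_order all_algebra.

Set Implicit Arguments.
Unset Strict Implicit.
Unset Printing Implicit Defensive.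

Import GRing.Theory Num.Theory.
Local Open Scope ring_scope.

(* The subring of the rationals with denominator coprime to p; [denq x] is the
   positive denominator of x in lowest terms. *)
Definition p_integral (p : nat) : {pred rat} :=
  [pred x : rat | coprime `|denq x|%N p].

(* u = v modulo p ^ 2 in that ring; both u and v are required to belong to it. *)
Definition eqmod_p2 (p : nat) (u v : rat) : Prop :=
  [/\ u \in p_integral p, v \in p_integral p
    & (u - v) / p%:R ^+ 2 \in p_integral p].

(* Main.v *)
Require Import Defs.
From HB Require Import structures.
From mathcomp Require Import all_boot all_order all_fingroup all_algebra.
From mathcomp Require Import all_solvable all_field.
From mathcomp Require Import ring zify.

Set Implicit Arguments.
Unset Strict Implicit.
Unset Printing Implicit Defensive.

Import Order.TTheory GRing.Theory Num.Theory.
Local Open Scope ring_scope.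

(** Write h = (p-1)/2, m = [p/8] and C for the binomial coefficient (h choose
    m). The congruence comes from evaluating one quadratic character sum in
    two ways: exactly, which produces the integer c, and modulo p^2, which
    produces the same binomial coefficients as the truncated sum.

    The truncated sum. Its k-th term is the value at y = -3/16 of a polynomial
    G_k in y whose value at y = N(N+1) is the k-th term of the Legendre
    polynomial P_N at 0. For N = 2m = [p/4] and N' = p-1-N, the numbers -3/16,
    N(N+1) and N'(N'+1) agree modulo p, and on a residue class modulo p a
    polynomial is affine modulo p^2. Hence the sum is
    (3 P_N(0) + P_N'(0)) / 4 modulo p^2. Moreover P_2r(0) = (-1/2 choose r),
    and since -1/2 = h - p/2 the same interpolation writes this as
    (3 (h choose r) - (h+p choose r)) / 2. The result is that twice the sum S
    satisfies 2S = (1 + sg p) D modulo p^2, where D = 3C - X - Y, sg is -1 or 1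
    according as p is 1 or 3 modulo 8, and X and Y are binomial coefficients
    with upper index h+p-1 (truncated_sum_split, truncated_sum_inert).

    The character sum. Let chi be the quadratic character of F_p and let g
    generate F_p^* if p = 1 modulo 8, and the group of elements of norm 1 in
    the field with p^2 elements if p = 3 modulo 8. This group has order
    n = sg (1 + sg p), divisible by 4. The sum of (-1)^k chi(g^(2k) + g^(-2k))
    over k < n is 4A with A an integer. It belongs to a family of twisted sums
    4 B(e) with B(0) = A, whose second moment is computable; the symmetries
    B(e+4) = - B(e), B(2) = 0 and B(3) = B(1) up to sign turn this into
    p = B(0)^2 + 2 B(1)^2. As representations of p are unique, A = c or -c,
    and counting terms modulo 4 shows that A = (-1)^(m+1) c.

    Comparison. For integers z one has 2 chi(z) = 3 z^h - z^(3h) modulo p^2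
    (qchar_lift), and g lifts to a root of unity of order n in a ring of
    characteristic p^2. Summing over that group picks coefficients out of
    (g^2 + g^(-2))^h and (g^2 + g^(-2))^(3h), and yields
    4A = n (D - Z) modulo p^2, with the same D and with
    Z = (h+p-1 choose h+m) = p Z'. Wilson's theorem gives Z' C = -2 modulo p
    (bin_top_Fp), and D = 2C modulo p. With A' = sg A this reads
    2S = 4A' + p Z' and Z' = - 1 / A' modulo p, so that
    S = 2A' - p / (2A') modulo p^2, which is the claim. *)

(** * p-integral rationals and functions that are affine modulo p^2 *)
Lemma p_integralP p x :
  reflect (exists a : int, exists2 b : nat, coprime b p & x * b%:R = a%:~R)
          (x \in p_integral p).
Proof.
apply: (iffP idP) => [xp|[a [b bp xb]]].
  exists (numq x), `|denq x|%N; first exact: xp.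
  rewrite -[X in X * _]divq_num_den -[_%:R]/((`|denq x|%N : int)%:~R).
  by rewrite gez0_abs ?denq_ge0 // divfK // intr_eq0 denq_neq0.
have /intr_inj e : (numq x * b)%:~R = (a * denq x)%:~R :> rat.
  by rewrite !intrM -xb numqE -[b%:~R]/(b%:R : rat); ring.
rewrite /p_integral inE /=; apply: coprime_dvdl bp.
have : (`|denq x| %| `|numq x| * b)%N.
  by rewrite -(absz_nat b) -abszM e abszM dvdn_mull.
by rewrite Gauss_dvdr // coprime_sym coprime_num_den.
Qed.

Fact p_integral_subring p : subring_closed (p_integral p).
Proof.
split=> [|x y /p_integralP[a [b bp xb]] /p_integralP[a' [b' bp' yb]]
         |x y /p_integralP[a [b bp xb]] /p_integralP[a' [b' bp' yb]]].
- by apply/p_integralP; exists 1, 1%N; rewrite ?coprime1n ?mulr1.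
- apply/p_integralP; exists (a * b' - a' * b), (b * b')%N.
    by rewrite coprimeMl bp.
  by rewrite natrM intrB !intrM -xb -yb -!pmulrn; ring.
- apply/p_integralP; exists (a * a'), (b * b')%N.
    by rewrite coprimeMl bp.
  by rewrite natrM intrM -xb -yb; ring.
Qed.

HB.instance Definition _ p :=
  GRing.isSubringClosed.Build rat (p_integral p) (p_integral_subring p).

Lemma p_integral_natV p n : coprime n p -> n%:R^-1 \in p_integral p.
Proof.
move=> np; apply/p_integralP; exists (n != 0)%N, n => //.
by case: n np => [|n] _; rewrite ?mulr0 ?mulVf ?pnatr_eq0.
Qed.

(** The quotient of the difference is kept as an explicit witness, so that
    congruences can be combined by computing with equations. *)
Definition cong p e (x y : rat) :=
  exists2 z, z \in p_integral p & x = y + p%:R ^+ e * z.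

Section Smooth.
Variable p : nat.
Notation Zp := (p_integral p).

(** [f] preserves p-integrality and has a derivative modulo p^2: on every
    residue class modulo p it is affine modulo p^2. *)
Definition smooth (f : rat -> rat) :=
  forall x, x \in Zp -> f x \in Zp /\
    exists2 d, d \in Zp &
      forall y, y \in Zp -> cong p 2 (f (x + p%:R * y)) (f x + p%:R * y * d).

Lemma smooth_linear a b : a \in Zp -> b \in Zp -> smooth (fun x => a * x + b).
Proof.
move=> aZ bZ x xZ; split; first by rewrite rpredD ?rpredM.
exists a => // y _; exists 0; rewrite ?rpred0 //; ring.
Qed.

Lemma smooth_mul f g : smooth f -> smooth g -> smooth (fun x => f x * g x).
Proof.
move=> Hf Hg x xZ; have [fZ [d dZ Hd]] := Hf x xZ.
have [gZ [d' dZ' Hd']] := Hg x xZ; split; first by rewrite rpredM.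
exists (f x * d' + g x * d); first by rewrite rpredD ?rpredM.
move=> y yZ; have [z zZ ->] := Hd y yZ; have [z' zZ' ->] := Hd' y yZ.
exists (z * (g x + p%:R * y * d' + p%:R ^+ 2 * z') + (f x + p%:R * y * d) * z'
        + y * d * y * d').
  by rewrite !(rpredD, rpredM, rpredX) ?rpred_nat.
ring.
Qed.

Lemma smooth_add f g : smooth f -> smooth g -> smooth (fun x => f x + g x).
Proof.
move=> Hf Hg x xZ; have [fZ [d dZ Hd]] := Hf x xZ.
have [gZ [d' dZ' Hd']] := Hg x xZ; split; first by rewrite rpredD.
exists (d' + d); first by rewrite rpredD.
move=> y yZ; have [z zZ ->] := Hd y yZ; have [z' zZ' ->] := Hd' y yZ.
exists (z + z'); first by rewrite rpredD.
ring.
Qed.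

Lemma smooth_const a : a \in Zp -> smooth (fun=> a).
Proof.
move=> aZ x xZ; split=> //; exists 0; rewrite ?rpred0 // => y _.
by exists 0; rewrite ?rpred0 //; ring.
Qed.

Lemma smooth_eq f g : f =1 g -> smooth f -> smooth g.
Proof.
move=> efg Hf x xZ; have [fZ [d dZ Hd]] := Hf x xZ; rewrite -!efg; split=> //.
by exists d => // y yZ; rewrite -!efg; apply: Hd.
Qed.

Lemma smooth_prod n (f : nat -> rat -> rat) :
  (forall i, (i < n)%N -> smooth (f i)) ->
  smooth (fun x => \prod_(0 <= i < n) f i x).
Proof.
elim: n => [|n IHn] Hf.
  by apply: (@smooth_eq (fun=> 1)) => [x|]; [rewrite big_geq|apply/smooth_const/rpred1].
apply: (@smooth_eq (fun x => (\prod_(0 <= i < n) f i x) * f n x)).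
  by move=> x; rewrite big_nat_recr.
by apply: smooth_mul; [apply: IHn => i /ltnW; apply: Hf|apply: Hf].
Qed.

Lemma smooth_sum n (f : nat -> rat -> rat) :
  (forall i, (i < n)%N -> smooth (f i)) ->
  smooth (fun x => \sum_(0 <= i < n) f i x).
Proof.
elim: n => [|n IHn] Hf.
  by apply: (@smooth_eq (fun=> 0)) => [x|]; [rewrite big_geq|apply/smooth_const/rpred0].
apply: (@smooth_eq (fun x => (\sum_(0 <= i < n) f i x) + f n x)).
  by move=> x; rewrite big_nat_recr.
by apply: smooth_add; [apply: IHn => i /ltnW; apply: Hf|apply: Hf].
Qed.

(** An affine function is determined by two values. The error term [s] costs
    nothing, because an argument only matters modulo p^2. *)
Lemma smooth_interp f x y1 y2 s t : smooth f ->
    x \in Zp -> y2 \in Zp -> s \in Zp -> t \in Zp -> y1 = t * y2 + p%:R * s ->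
  cong p 2 (f (x + p%:R * y1)) ((1 - t) * f x + t * f (x + p%:R * y2)).
Proof.
move=> Hf xZ yZ sZ tZ ->; have [fZ [d dZ Hd]] := Hf x xZ.
have [|z zZ ->] := Hd (t * y2 + p%:R * s).
  by rewrite !(rpredD, rpredM) ?rpred_nat.
have [z' zZ' ->] := Hd y2 yZ.
exists (s * d + z - t * z'); first by rewrite !(rpredB, rpredD, rpredM).
ring.
Qed.

End Smooth.

Definition gbinom (x : rat) r : rat := \prod_(0 <= i < r) ((x - i%:R) / i.+1%:R).

Lemma gbinom_nat n r : gbinom n%:R r = 'C(n, r)%:R.
Proof.
rewrite /gbinom; elim: r => [|r IHr]; first by rewrite big_geq ?bin0.
rewrite big_nat_recr //= IHr; have [nr|rn] := leqP n r.
  rewrite (bin_small (_ : n < r.+1)%N) //; move: nr; rewrite leq_eqVlt.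
  by case/predU1P=> [->|nr]; rewrite ?subrr ?(bin_small nr) !(mul0r, mulr0).
rewrite -natrB 1?ltnW // mulrA -natrM mulnC -mul_bin_left natrM mulrC mulKf //.
by rewrite pnatr_eq0.
Qed.

Lemma natf_fact_neq0 n : n`!%:R != 0 :> rat.
Proof. by rewrite pnatr_eq0 -lt0n fact_gt0. Qed.

Lemma central_binE n : 'C(2 * n, n)%:R = (2 * n)`!%:R / n`!%:R ^+ 2 :> rat.
Proof.
have := @bin_fact (2 * n) n; rewrite (_ : (2 * n - n = n)%N); last by lia.
by move=> <-; [rewrite !natrM; field; rewrite natf_fact_neq0|lia].
Qed.

Lemma gbinom_half r : gbinom (- (1 / 2%:R)) r = (-1) ^+ r * 'C(2 * r, r)%:R / 4%:R ^+ r.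
Proof.
rewrite /gbinom; elim: r => [|r IHr]; first by rewrite big_geq ?bin0 ?mulr1 ?divr1.
rewrite big_nat_recr //= IHr.
rewrite !central_binE (_ : (2 * r.+1 = (2 * r).+2)%N); last by lia.
have r_neq : r%:R + 1 != 0 :> rat by rewrite natr1 pnatr_eq0.
have r2_neq : 2%:R * r%:R + 1 != 0 :> rat by rewrite -natrM natr1 pnatr_eq0.
rewrite !factS !natrM -!natr1 !natrM !exprS; field.
by rewrite ?r_neq ?r2_neq ?natf_fact_neq0 ?expf_neq0.
Qed.

(** The k-th term of the Legendre polynomial P_N at 0 depends on N only through
    y = N (N + 1). This form also makes sense at y = -3/16 = a (a + 1), with
    a = -1/4 or a = -3/4. *)
Definition legendre_term k (y : rat) : rat :=
  \prod_(0 <= j < k) ((y - (j * j.+1)%:R) * (- (1 / 2%:R)) / j.+1%:R ^+ 2).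

Lemma legendre_term_nat N k :
  legendre_term k (N * N.+1)%:R = ('C(N, k) * 'C(N + k, k))%:R * (- (1 / 2%:R)) ^+ k.
Proof.
rewrite /legendre_term; elim: k => [|k IHk]; first by rewrite big_geq ?bin0 ?mulr1.
rewrite big_nat_recr //= IHk [in RHS]exprSr.
have k0 : k.+1%:R != 0 :> rat by rewrite pnatr_eq0.
have e1 : k.+1%:R * 'C(N, k.+1)%:R = (N%:R - k%:R) * 'C(N, k)%:R :> rat.
  rewrite -natrM mul_bin_left natrM; have [kN|Nk] := leqP k N; first by rewrite natrB.
  by rewrite bin_small // !mulr0.
have e2 : k.+1%:R * 'C(N + k.+1, k.+1)%:R = (N + k.+1)%:R * 'C(N + k, k)%:R :> rat.
  by rewrite -!natrM addnS -mul_bin_diag.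
have /(canRL (mulKf k0)) -> : k.+1%:R * ('C(N, k.+1) * 'C(N + k.+1, k.+1))%:R =
    k.+1%:R^-1 * ((N%:R - k%:R) * 'C(N, k)%:R * ((N + k.+1)%:R * 'C(N + k, k)%:R)) :> rat.
  by rewrite -e1 -e2 natrM; field; rewrite nat1r.
rewrite !natrM natrD -!natr1; field.
by rewrite ?natr1 ?nat1r ?k0.
Qed.

Lemma legendre_term_frac k :
  legendre_term k (- (3%:R / 16%:R)) = ('C(2 * k, k) * 'C(4 * k, 2 * k))%:R / 128%:R ^+ k.
Proof.
rewrite natrM (_ : (4 * k = 2 * (2 * k))%N) ?central_binE; last by lia.
rewrite /legendre_term; elim: k => [|k IHk]; first by rewrite big_geq // !divr1.
rewrite big_nat_recr //= IHk.
have -> : (2 * (2 * k.+1) = (2 * (2 * k)).+4)%N by lia.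
have -> : (2 * k.+1 = (2 * k).+2)%N by lia.
have k_neq : k%:R + 1 != 0 :> rat by rewrite natr1 pnatr_eq0.
have k2_neq : 2%:R * k%:R + 1 != 0 :> rat by rewrite -natrM natr1 pnatr_eq0.
have -> : (k.+1)`!%:R = (k%:R + 1) * k`!%:R :> rat by rewrite factS natrM -natr1.
have -> : (2 * k).+2`!%:R = (2%:R * k%:R + 2%:R) * (2%:R * k%:R + 1) * (2 * k)`!%:R :> rat.
  by rewrite !factS -!natrM natr1 -!natrD -!natrM; congr _%:R; lia.
have -> : (2 * (2 * k)).+4`!%:R =
    (4%:R * k%:R + 4%:R) * (4%:R * k%:R + 3%:R) * (4%:R * k%:R + 2%:R)
    * (4%:R * k%:R + 1) * (2 * (2 * k))`!%:R :> rat.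
  by rewrite !factS -!natrM natr1 -!natrD -!natrM; congr _%:R; lia.
have f1 := natf_fact_neq0 k; have f2 := natf_fact_neq0 (2 * k).
have : 128%:R ^+ k != 0 :> rat by apply: expf_neq0; rewrite pnatr_eq0.
rewrite natrM -natr1 [128%:R ^+ k.+1]exprS; move: (128%:R ^+ k) => u u_neq.
have k3_neq : 2%:R * k%:R + 2%:R != 0 :> rat by rewrite -natrM -natrD pnatr_eq0; lia.
field.
by rewrite k_neq k2_neq k3_neq f1 f2 u_neq.
Qed.

Lemma coef_1DX_exp n i : ((1 + 'X : {poly rat}) ^+ n)`_i = 'C(n, i)%:R.
Proof.
rewrite exprDn coef_sum; have [ni|iN] := ltnP n i.
  rewrite bin_small // big1 // => j _; rewrite coefMn expr1n mul1r coefXn.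
  by have := ltn_ord j; case: eqP => [|_]; rewrite ?mul0rn //; lia.
rewrite -ltnS in iN; rewrite (bigD1 (Ordinal iN)) //= big1 => [|j ji].
  by rewrite coefMn expr1n mul1r coefXn eqxx addr0.
rewrite coefMn expr1n mul1r coefXn eq_sym.
by have /negPf -> : (j : nat) != i by []; rewrite mul0rn.
Qed.

(** Both sides are the coefficient of X^N, with N = 2r, in
    (1 + X)^N (1 - (1 + X) / 2)^N = 2^(-N) (1 - X^2)^N, expanded with respect to
    the second factor on the left. *)
Lemma legendre_at0 r :
  \sum_(k < (2 * r).+1) ('C(2 * r, k) * 'C(2 * r + k, k))%:R * (- (1 / 2%:R)) ^+ k
    = gbinom (- (1 / 2%:R)) r.
Proof.
set N := (2 * r)%N; set z : rat := - (1 / 2%:R).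
pose P : {poly rat} := (1 + 'X) ^+ N * (1 + z *: (1 + 'X)) ^+ N.
transitivity P`_N.
  rewrite /P [(1 + z *: _) ^+ N]exprDn mulr_sumr coef_sum; apply: eq_bigr => k _.
  rewrite expr1n mul1r exprZn mulrnAr -scalerAr -exprD coefMn coefZ coef_1DX_exp.
  rewrite -[RHS]mulr_natr natrM -(bin_sub (leq_addl N k)) addnK; ring.
have -> : P = (2%:R^-1) ^+ N *: (1 + - 'X^2) ^+ N.
  (* The constant 1 is split as 1/2 + 1/2 to make both sides multiples of 1/2. *)
  pose a : {poly rat} := (2%:R^-1)%:P.
  have aa : 1 = a + a by rewrite -polyCD (_ : _ + _ = 1).
  rewrite -exprZn /P -exprMn -!mul_polyC (_ : z%:P = - a); last first.
    by rewrite /z div1r polyCN.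
  by congr (_ ^+ N); rewrite {2}aa -/a; ring.
rewrite coefZ exprDn coef_sum (bigD1 (inord r)) //= big1 => [|j jr].
  rewrite inordK; last by rewrite /N; lia.
  rewrite expr1n mul1r -mulN1r exprMn -exprM coefMn addr0 -polyCN -rmorphXn /=.
  rewrite coefCM coefXn eqxx mulr1 gbinom_half -/N exprVn /N exprM.
  by rewrite -mulr_natr -natrX; ring.
rewrite expr1n mul1r -mulN1r exprMn -exprM coefMn -polyCN -rmorphXn /=.
rewrite coefCM coefXn; case: eqP => [e|_]; last by rewrite mulr0 mul0rn.
case/eqP: jr; apply/val_inj; rewrite /= inordK; move: e; rewrite /N; lia.
Qed.

Lemma p_integral_natV_lt p j : prime p -> (0 < j < p)%N -> j%:R^-1 \in p_integral p.
Proof.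
move=> pp /andP[j0 jp]; apply: p_integral_natV; rewrite coprime_sym prime_coprime //.
by apply/negP => /dvdn_leq; lia.
Qed.

Lemma smooth_gbinom p r : prime p -> (r < p)%N -> smooth p (gbinom^~ r).
Proof.
move=> pp rp; apply: smooth_prod => i ir.
have iZ := @p_integral_natV_lt p i.+1 pp.
apply: (@smooth_eq _ (fun x => i.+1%:R^-1 * x + - (i%:R / i.+1%:R))).
  by move=> x; rewrite mulrBl [_^-1 * _]mulrC.
by apply: smooth_linear; rewrite ?rpredN ?rpredM ?rpred_nat // iZ //; lia.
Qed.

Lemma smooth_legendre_term p k : prime p -> (2 < p)%N -> (k < p)%N -> smooth p (legendre_term k).
Proof.
move=> pp p2 kp; apply: smooth_prod => j jk.
have jZ : j.+1%:R^-1 \in p_integral p by apply: p_integral_natV_lt => //; lia.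
have hZ : 2%:R^-1 \in p_integral p by apply: p_integral_natV_lt => //; lia.
pose a : rat := - (2%:R^-1) * j.+1%:R^-1 ^+ 2.
have aZ : a \in p_integral p by rewrite rpredM ?rpredN ?rpredX.
apply: (@smooth_eq _ (fun x => a * x + - (j * j.+1)%:R * a)).
  by move=> x; rewrite /a div1r exprVn; ring.
by apply: smooth_linear; rewrite // rpredM ?rpredN ?rpred_nat.
Qed.

(** Since -1/2 = h + p (-1/2), interpolating between h and h + p gives the
    weights 3/2 and -1/2. *)
Lemma gbinom_half_cong p h r : prime p -> p = (2 * h).+1 -> (r < p)%N ->
  cong p 2 (gbinom (- (1 / 2%:R)) r)
    (3%:R / 2%:R * 'C(h, r)%:R - 1 / 2%:R * 'C(h + p, r)%:R).
Proof.
move=> pp ph rp; have hZ : 2%:R^-1 \in p_integral p.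
  by apply: p_integral_natV_lt => //; have := prime_gt1 pp; lia.
have pE : p%:R = 2%:R * h%:R + 1 :> rat by rewrite ph -natr1 natrM.
have [||||||z zZ] := @smooth_interp p (gbinom^~ r) h%:R (- (1 / 2%:R)) 1 0 (- (1 / 2%:R)).
- exact: smooth_gbinom.
- exact: rpred_nat.
- exact: rpred1.
- exact: rpred0.
- by rewrite div1r rpredN.
- by rewrite mulr1 mulr0 addr0.
have -> : h%:R + p%:R * - (1 / 2%:R) = - (1 / 2%:R) :> rat by rewrite pE; field.
rewrite mulr1 -(natrD _ h p) !gbinom_nat => ->; exists z => //; move: z {zZ} => z.
by move: ('C(h, r)%:R : rat) ('C(h + p, r)%:R : rat) => u v; field.
Qed.

Definition truncated_sum p : rat :=
  \sum_(0 <= k < p) ('C(2 * k, k) * 'C(4 * k, 2 * k))%N%:R / 128%:R ^+ k.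

Lemma sum_legendre_term p r : (2 * r < p)%N ->
  \sum_(0 <= k < p) legendre_term k (2 * r * (2 * r).+1)%:R = gbinom (- (1 / 2%:R)) r.
Proof.
move=> rp; rewrite -legendre_at0 (@big_cat_nat _ _ _ (2 * r).+1) //=.
rewrite [X in _ + X]big1_seq ?addr0 => [|k]; last first.
  rewrite mem_index_iota => /andP[_ /andP[rk _]].
  by rewrite legendre_term_nat bin_small // mul0n mul0r.
by rewrite big_mkord; apply: eq_bigr => k _; apply: legendre_term_nat.
Qed.

(** One of -1/4 and -3/4 is N - p/4 with N = 2m. Hence -3/16 lies one quarter of
    the way from N (N + 1) to N' (N' + 1), where N' = p - 1 - N = 2 (h - m), up
    to a multiple of p^2. *)
Lemma truncated_sum_cong p h m : prime p -> p = (2 * h).+1 ->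
    (h = 4 * m)%N \/ (h = (4 * m).+1)%N ->
  cong p 2 (truncated_sum p)
    (3%:R / 2%:R * 'C(h, m)%:R - 3%:R / 8%:R * 'C(h + p, m)%:R
      - 1 / 8%:R * 'C(h + p, h - m)%:R).
Proof.
move=> pp ph hm; have p2 : (2 < p)%N by have := prime_gt1 pp; lia.
have hZ : 2%:R^-1 \in p_integral p by apply: p_integral_natV_lt => //; lia.
have qZ : 4%:R^-1 \in p_integral p.
  have -> : 4%:R^-1 = 2%:R^-1 * 2%:R^-1 :> rat by [].
  exact: rpredM.
pose N := (2 * m)%N; pose N' := (2 * (h - m))%N.
have [||||||z zZ] := @smooth_interp p (fun x => \sum_(0 <= k < p) legendre_term k x)
   (N * N.+1)%:R ((p%:R - 4%:R * (N.*2.+1)%:R) / 4%:R / 4%:R) (p%:R - (N.*2.+1)%:R)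
   (- (3%:R / 4%:R / 4%:R)) (4%:R^-1).
- by apply: smooth_sum => k kp; apply: smooth_legendre_term.
- exact: rpred_nat.
- by rewrite rpredB ?rpred_nat.
- by rewrite rpredN !rpredM ?rpred_nat.
- exact: qZ.
- by field.
have -> : (N * N.+1)%:R + p%:R * ((p%:R - 4%:R * (N.*2.+1)%:R) / 4%:R / 4%:R)
   = - (3%:R / 16%:R) :> rat.
  rewrite -mul2n (natrM _ N) -!natr1 (natrM _ 2 N).
  have [e|e] : (p = 4 * N + 1)%N \/ (p = 4 * N + 3)%N by rewrite /N; lia.
    by rewrite e natrD (natrM _ 4 N); field.
  by rewrite e natrD (natrM _ 4 N); field.
have -> : (N * N.+1)%:R + p%:R * (p%:R - (N.*2.+1)%:R) = (N' * N'.+1)%:R :> rat.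
  have -> : p%:R = (N + N')%:R + 1 :> rat by rewrite natr1 /N /N'; congr _%:R; lia.
  by rewrite -mul2n (natrM _ N) (natrM _ N') -!natr1 natrD (natrM _ 2 N); ring.
have -> : \sum_(0 <= k < p) legendre_term k (N * N.+1)%:R = gbinom (- (1 / 2%:R)) m.
  by apply: sum_legendre_term; lia.
have -> : \sum_(0 <= k < p) legendre_term k (N' * N'.+1)%:R = gbinom (- (1 / 2%:R)) (h - m).
  by apply: sum_legendre_term; lia.
have -> : \sum_(0 <= k < p) legendre_term k (- (3%:R / 16%:R)) = truncated_sum p.
  by apply: eq_bigr => k _; apply: legendre_term_frac.
have [z1 z1Z ->] := @gbinom_half_cong p h m pp ph ltac:(lia).
have [z2 z2Z ->] := @gbinom_half_cong p h (h - m) pp ph ltac:(lia).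
rewrite bin_sub; last by lia.
move=> ->; exists (z + 3%:R / 4%:R * z1 + z2 / 4%:R).
  by apply: rpredD; [apply: rpredD|] => //; rewrite !rpredM ?rpred_nat.
by field.
Qed.

(** * Binomial coefficients modulo p *)
Section Factorials.
Variables (p : nat) (pp : prime p).
Let chp := pchar_Fp pp.

Lemma Fp_eq0 n : (n%:R == 0 :> 'F_p) = (p %| n)%N.
Proof. by rewrite (dvdn_pcharf chp). Qed.

Lemma fact_reflect_Fp k : (k < p)%N ->
  (k`! * (p.-1 - k)`!)%:R = (-1) ^+ k.+1 :> 'F_p.
Proof.
have p1 := prime_gt1 pp; elim: k => [|k IHk] kp.
  rewrite fact0 mul1n subn0 expr1; apply/eqP; rewrite -subr_eq0 opprK natr1.
  by rewrite Fp_eq0 -Wilson.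
rewrite exprS -IHk 1?ltnW // (_ : p.-1 - k = (p.-1 - k.+1).+1)%N; last by lia.
rewrite !factS !natrM.
have -> : (p.-1 - k.+1).+1%:R = - k.+1%:R :> 'F_p.
  apply/eqP; rewrite -subr_eq0 opprK -natrD (_ : _ + _ = p)%N ?Fp_eq0 //; lia.
ring.
Qed.

Lemma fact_shift_Fp j : exists2 W : nat, ((p + j)`! = p`! * W)%N & W%:R = j`!%:R :> 'F_p.
Proof.
elim: j => [|j [W eW WF]]; first by exists 1%N; rewrite ?addn0 ?muln1 ?fact0.
exists ((p + j.+1) * W)%N; first by rewrite addnS factS eW; lia.
by rewrite natrM WF natrD (pcharf0 chp) add0r factS natrM.
Qed.

(** Every factorial below is paired with its complement k! (p-1-k)! = (-1)^(k+1)
    modulo p; what remains is (h!)^2 / h, and h = -1/2 modulo p. *)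
Lemma bin_top_Fp h m : p = (2 * h).+1 -> (m <= h)%N ->
  exists2 Z, 'C(h + p.-1, h + m) = (p * Z)%N & (p %| Z * 'C(h, m) + 2)%N.
Proof.
move=> ph mh; have p1 := prime_gt1 pp.
have h0 : (0 < h)%N by lia.
have [W eW WF] := fact_shift_Fp h.-1.
have e1 : ('C(h + p.-1, h + m) * ((h + m)`! * (p.-1 - m)`!) = p`! * W)%N.
  rewrite -eW -(_ : h + p.-1 = p + h.-1)%N; last by lia.
  rewrite -(@bin_fact (h + p.-1) (h + m)); last by lia.
  by rewrite (_ : h + p.-1 - (h + m) = p.-1 - m)%N; last by lia.
have pNfact k : (k < p)%N -> ~~ (p %| k`!)%N.
  elim: k => [|k IHk] kp; first by rewrite fact0 dvdn1; lia.
  rewrite factS Euclid_dvdM // negb_or IHk 1?ltnW // andbT.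
  by apply/negP => /dvdn_leq; lia.
have : (p %| 'C(h + p.-1, h + m))%N.
  have : (p %| 'C(h + p.-1, h + m) * ((h + m)`! * (p.-1 - m)`!))%N.
    by rewrite e1 -(prednK (prime_gt0 pp)) factS -mulnA dvdn_mulr.
  rewrite Euclid_dvdM // => /orP[//|]; rewrite Euclid_dvdM // => /orP[] H.
    by have := pNfact (h + m)%N ltac:(lia); rewrite H.
  by have := pNfact (p.-1 - m)%N ltac:(lia); rewrite H.
case/dvdnP => Z eZ; exists Z; first by rewrite mulnC.
have e2 : (Z * ((h + m)`! * (p.-1 - m)`!) = p.-1`! * W)%N.
  apply/eqP; rewrite -(eqn_pmul2l (prime_gt0 pp)) !mulnA (mulnC p Z) -eZ -mulnA e1.
  by rewrite -{1}(prednK (prime_gt0 pp)) factS prednK ?prime_gt0 // mulnA.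
rewrite -Fp_eq0 natrD natrM.
have /(congr1 (fun n => n%:R : 'F_p)) := e2; rewrite !natrM WF => e3.
have g1 := @fact_reflect_Fp (h + m) ltac:(lia).
have g2 := @fact_reflect_Fp m ltac:(lia).
have g3 := @fact_reflect_Fp h ltac:(lia).
have g4 := @fact_reflect_Fp 0 ltac:(lia).
have hE : h`!%:R = h%:R * h.-1`!%:R :> 'F_p by rewrite -natrM -[in LHS](prednK h0) factS prednK.
have cE : 'C(h, m)%:R * (m`!%:R * (h - m)`!%:R) = h`!%:R :> 'F_p by rewrite -!natrM bin_fact.
have h2 : 2%:R * h%:R = -1 :> 'F_p.
  by apply/eqP; rewrite -subr_eq0 opprK -natrM natr1 -ph Fp_eq0.
move: g1 g2 g3 g4; rewrite (_ : p.-1 - (h + m) = h - m)%N; last by lia.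
rewrite (_ : p.-1 - h = h)%N; last by lia.
rewrite fact0 mul1n subn0 expr1 !natrM => g1 g2 g3 g4.
rewrite g4 in e3.
have u_sq k : ((-1) ^+ k) ^+ 2 = 1 :> 'F_p by rewrite sqrr_sign.
have key : h%:R * (Z%:R * 'C(h, m)%:R) = 1 :> 'F_p.
  have : h%:R * (Z%:R * 'C(h, m)%:R) * ((-1) ^+ (h + m).+1 * (-1) ^+ m.+1) = (-1) ^+ h :> 'F_p.
    have -> : (-1) ^+ h = - (-1) ^+ h.+1 :> 'F_p by rewrite exprS mulN1r opprK.
    rewrite -g1 -g2 -g3 {1}hE -cE.
    transitivity (h%:R * 'C(h, m)%:R * (m`!%:R * (h - m)`!%:R)
      * (Z%:R * ((h + m)`!%:R * (p.-1 - m)`!%:R)) : 'F_p).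
      ring.
    by rewrite e3; ring.
  rewrite !exprS exprD; move: (u_sq h) (u_sq m).
  move: ((-1) ^+ h) ((-1) ^+ m) (h%:R * _) => a b K ea eb E.
  transitivity (K * (-1 * (a * b) * (-1 * b)) * a); last by rewrite E -expr2.
  transitivity (K * (a ^+ 2 * b ^+ 2)); first by rewrite ea eb !mulr1.
  ring.
have -> : Z%:R * 'C(h, m)%:R = - (2%:R * (h%:R * (Z%:R * 'C(h, m)%:R))) :> 'F_p.
  by rewrite [2%:R * _]mulrA h2 mulN1r opprK.
by rewrite key mulr1 addNr.
Qed.
End Factorials.

Lemma bin_shift_cong p h r : prime p -> (r < p)%N ->
  exists2 q, q \in p_integral p & 'C(h + p, r)%:R = 'C(h, r)%:R + p%:R * q :> rat.
Proof.
move=> pp rp; have [_ [d dZ H]] := @smooth_gbinom p r pp rp h%:R (rpred_nat _ _).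
have [z zZ] := H 1 (rpred1 _); rewrite mulr1 -(natrD _ h p) !gbinom_nat => ->.
exists (d + p%:R * z); first by rewrite rpredD ?rpredM ?rpred_nat.
ring.
Qed.

(** * From the unit root to the right-hand side *)
Lemma p_integral_1DpV p z : prime p -> z \in p_integral p ->
  1 + p%:R * z != 0 /\ (1 + p%:R * z)^-1 \in p_integral p.
Proof.
move=> pp /p_integralP[a [b bp zb]].
have b0 : (b != 0)%N by apply/eqP => b0; move: bp (prime_gt1 pp); rewrite b0 /coprime gcd0n; lia.
have bR : b%:R != 0 :> rat by rewrite pnatr_eq0.
pose c : int := b%:Z + p%:Z * a.
have cp : coprime `|c| p.
  rewrite coprime_sym prime_coprime // -[(_ %| _)%N]/(p%:Z %| c)%Z rpredDr ?dvdz_mulr //.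
  by rewrite -[(_ %| _)%Z]/(p %| b)%N -prime_coprime // coprime_sym.
have c0 : c != 0 by apply: contraL cp => /eqP->; rewrite /coprime gcd0n; have := prime_gt1 pp; lia.
have e : 1 + p%:R * z = c%:~R / b%:R.
  by rewrite /c intrD intrM -zb -!pmulrn; field.
rewrite e mulf_neq0 ?invr_neq0 ?intr_eq0 //; split=> //.
have cR : c%:~R != 0 :> rat by rewrite intr_eq0.
rewrite invf_div; apply/p_integralP; exists (if 0 <= c then b%:Z else - b%:Z), `|c|%N => //.
rewrite natr_absz; case: ger0P => _; first by rewrite divfK.
by rewrite !rmorphN /= mulrN divfK.
Qed.

(** If u is the root of u + p/u = 2A that is a unit, then u = 2A - p/(2A)
    modulo p^2. The hypotheses give 2S = 4A + pZ with ZA = -1 modulo p, which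
    is this value of S. *)
Lemma unit_root_mod_p2 p (S A C D Z sg : rat) : prime p -> (2 < p)%N ->
    {subset [:: A; C; D; Z; sg] <= p_integral p} ->
    cong p 2 (2%:R * S) ((1 + sg * p%:R) * D) ->
    cong p 2 (4%:R * A) ((1 + sg * p%:R) * (D - p%:R * Z)) ->
    cong p 1 D (2%:R * C) -> cong p 1 (Z * C) (- 2%:R) ->
  (2%:R * A)^-1 \in p_integral p /\ cong p 2 S (2%:R * A - p%:R / (2%:R * A)).
Proof.
move=> pp p2 sub.
have [AZ CZ DZ] : [/\ A \in p_integral p, C \in p_integral p & D \in p_integral p].
  by split; apply: sub; rewrite !inE eqxx ?orbT.
have [ZZ sgZ] : Z \in p_integral p /\ sg \in p_integral p.
  by split; apply: sub; rewrite !inE eqxx ?orbT.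
have hZ : 2%:R^-1 \in p_integral p by apply: p_integral_natV_lt => //; lia.
case=> s sZ eS [k kZ eA] [d dZ eD] [z zZ eZ]; rewrite !expr1 in eD eZ.
pose e := d + sg * D - (1 + sg * p%:R) * Z + p%:R * k.
have eZp : e \in p_integral p.
  by rewrite rpredD ?rpredB ?rpredD ?rpredM ?rpredD ?rpredM ?rpred1 ?rpred_nat.
have eA' : 4%:R * A = 2%:R * C + p%:R * e by rewrite eA /e eD; ring.
have eC : C = 2%:R * A - p%:R * e / 2%:R by field: eA'.
pose g := 2%:R^-1 * (z + Z * e * 2%:R^-1).
have gZ : g \in p_integral p by rewrite rpredM // rpredD ?rpredM.
have AZE : A * (- Z) = 1 + p%:R * (- g).
  have -> : A * (- Z) = - (Z * C + p%:R * (Z * e * 2%:R^-1)) / 2%:R by rewrite eC; field.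
  by rewrite eZ /g; field.
have [|u_neq uZ] := @p_integral_1DpV p (- g) pp; first by rewrite rpredN.
have A0 : A != 0 by apply: contraNneq u_neq => A0; rewrite -AZE A0 mul0r.
have Z0 : - Z != 0 by apply: contraNneq u_neq => Z0; rewrite -AZE Z0 mulr0.
have AV : A^-1 = - Z / (1 + p%:R * - g) by rewrite -AZE invfM mulrCA mulfV ?mulr1.
have AVZ : A^-1 \in p_integral p by rewrite AV rpredM ?rpredN.
split; first by rewrite invfM rpredM.
exists ((g / A + sg * Z + s - k) / 2%:R).
  by rewrite rpredM // rpredB // rpredD // rpredD // rpredM.
have EZ : Z = - A^-1 + p%:R * g / A.
  by apply: (mulfI A0); rewrite -[LHS]opprK -mulrN AZE; field.
have : 2%:R * S = 4%:R * A + (1 + sg * p%:R) * p%:R * Z + p%:R ^+ 2 * (s - k).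
  by rewrite eS eA; ring.
move=> eS2; have -> : S = (2%:R * S) / 2%:R by field.
rewrite eS2 (_ : (1 + sg * p%:R) * p%:R * Z = p%:R * Z + p%:R^+2 * (sg * Z)); last by ring.
by rewrite {1}EZ; field.
Qed.

(** * The truncated sum in terms of integer binomial coefficients *)
Lemma p_integralD p x y : x \in p_integral p -> y \in p_integral p -> x + y \in p_integral p.
Proof. exact: rpredD. Qed.

Lemma p_integralM p x y : x \in p_integral p -> y \in p_integral p -> x * y \in p_integral p.
Proof. exact: rpredM. Qed.

Lemma p_integralN p x : x \in p_integral p -> - x \in p_integral p.
Proof. by rewrite rpredN. Qed.

Lemma p_integral_nat p n : n%:R \in p_integral p.
Proof. exact: rpred_nat. Qed.

Ltac p_integral_tac := repeat
  match goal with
  | |- is_true (_ + _ \in _) => apply: p_integralD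
  | |- is_true (_ * _ \in _) => apply: p_integralM
  | |- is_true (- _ \in _) => apply: p_integralN
  | |- is_true (_%:R \in _) => exact: p_integral_nat
  | |- is_true (1 \in _) => exact: (p_integral_nat _ 1)
  | _ => assumption
  end.

Lemma p_integral_3pB1V p : prime p ->
  3%:R * p%:R - 1 != 0 :> rat /\ (3%:R * p%:R - 1 : rat)^-1 \in p_integral p.
Proof.
move=> pp; have [|n0 nV] := @p_integral_1DpV p (- 3%:R) pp; first by rewrite rpredN rpred_nat.
have -> : 3%:R * p%:R - 1 = - (1 + p%:R * - 3%:R) :> rat by ring.
by rewrite oppr_eq0 invrN rpredN.
Qed.

(** The ratios of X and Y to (h+p choose m) and (h+p choose h-m) are exact
    rational functions of p with denominator 4 (3p - 1). After substituting
    them the terms of order 0 and 1 in p cancel; the witness is the rest. *)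
Lemma truncated_sum_split p m X Y : prime p -> p = (8 * m).+1 ->
    (X = 'C(12 * m, m))%N -> (Y = 'C(12 * m, 3 * m))%N ->
  let D : rat := 3%:R * 'C(4 * m, m)%:R - X%:R - Y%:R in
  cong p 2 (2%:R * truncated_sum p) ((1 + (-1) * p%:R) * D)
  /\ cong p 1 D (2%:R * 'C(4 * m, m)%:R).
Proof.
move=> pp pm eX eY D; have p2 : (2 < p)%N by have := prime_gt1 pp; lia.
have ph : p = (2 * (4 * m)).+1 by lia.
have qZ : 4%:R^-1 \in p_integral p.
  apply: p_integral_natV_lt => //.
  by have [m0|] := posnP m; [move: p2; rewrite pm m0|lia].
have [d0 dZ] := p_integral_3pB1V pp.
set d := (3%:R * p%:R - 1 : rat) in d0 dZ.
have pR : p%:R = 8%:R * m%:R + 1 :> rat by rewrite pm -natr1 natrM.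
have mR : m%:R = (p%:R - 1) / 8%:R :> rat by rewrite pR; field.
have [s sZ eS] := truncated_sum_cong pp ph (or_introl (erefl _)).
have [q1 q1Z eQ1] := @bin_shift_cong p (4 * m) m pp ltac:(lia).
have [q3 q3Z eQ3] := @bin_shift_cong p (4 * m) (3 * m) pp ltac:(lia).
have bsym : 'C(4 * m, 3 * m) = 'C(4 * m, m).
  by rewrite -bin_sub; [congr 'C(_, _)|]; lia.
rewrite bsym in eQ3.
have hpE : (4 * m + p)%:R = d / 2%:R :> rat.
  by rewrite (natrD _ (4 * m)) (natrM _ 4) mR /d; field.
have n12 : (4 * m + p).-1 = (12 * m)%N by lia.
have XE : X%:R = (11%:R * p%:R - 3%:R) / (4%:R * d) * 'C(4 * m + p, m)%:R.
  have := mul_bin_down (4 * m + p) m.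
  rewrite n12 -eX (_ : 4 * m + p - m = 11 * m + 1)%N; last by lia.
  move/(congr1 (fun n => n%:R : rat)); rewrite !natrM hpE (natrD _ (11 * m)) (natrM _ 11) mR => e.
  apply: (@mulfI _ (d / 2%:R)); first by rewrite mulf_neq0.
  by rewrite e; field.
have YE : Y%:R = (9%:R * p%:R - 1) / (4%:R * d) * 'C(4 * m + p, 3 * m)%:R.
  have := mul_bin_down (4 * m + p) (3 * m).
  rewrite n12 -eY (_ : 4 * m + p - 3 * m = 9 * m + 1)%N; last by lia.
  move/(congr1 (fun n => n%:R : rat)); rewrite !natrM hpE (natrD _ (9 * m)) (natrM _ 9) mR => e.
  apply: (@mulfI _ (d / 2%:R)); first by rewrite mulf_neq0.
  by rewrite e; field.
rewrite (_ : (4 * m - m = 3 * m)%N) in eS; last by lia.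
have CZ : 'C(4 * m, m)%:R \in p_integral p by apply: rpred_nat.
rewrite /D XE YE eS eQ1 eQ3; move: ('C(4 * m, m)%:R : rat) CZ => u uZ; split.
  exists (2%:R * s + d^-1 * (4%:R * u + q1 * (5%:R - 11%:R * p%:R) / 4%:R
             + q3 * (7%:R - 9%:R * p%:R) / 4%:R)).
    by p_integral_tac.
  by rewrite /d; field.
exists (- (2%:R * u / d) - (11%:R * p%:R - 3%:R) / (4%:R * d) * q1
                         - (9%:R * p%:R - 1) / (4%:R * d) * q3).
  by rewrite invfM; p_integral_tac.
by rewrite /d; field.
Qed.

(** The index 11m + 4 is that of (12m+3 choose m-1) reflected, which gives the
    value 0 when m = 0. *)
Lemma truncated_sum_inert p m X Y : prime p -> p = (8 * m + 3)%N ->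
    (X = 'C(12 * m + 3, 11 * m + 4))%N -> (Y = 'C(12 * m + 3, 3 * m))%N ->
  let D : rat := 3%:R * 'C(4 * m + 1, m)%:R - X%:R - Y%:R in
  cong p 2 (2%:R * truncated_sum p) ((1 + 1 * p%:R) * D)
  /\ cong p 1 D (2%:R * 'C(4 * m + 1, m)%:R).
Proof.
move=> pp pm eX eY D; have p2 : (2 < p)%N by lia.
have ph : p = (2 * (4 * m + 1)).+1 by lia.
have qZ : 4%:R^-1 \in p_integral p.
  have -> : 4%:R^-1 = 2%:R^-1 * 2%:R^-1 :> rat by [].
  by apply: rpredM; apply: p_integral_natV_lt => //; lia.
have [d0 dZ] := p_integral_3pB1V pp.
set d := (3%:R * p%:R - 1 : rat) in d0 dZ.
have pR : p%:R = 8%:R * m%:R + 3%:R :> rat by rewrite pm (natrD _ (8 * m)) (natrM _ 8).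
have mR : m%:R = (p%:R - 3%:R) / 8%:R :> rat by rewrite pR; field.
have [s sZ eS] := @truncated_sum_cong p (4 * m + 1) m pp ph (or_intror (addn1 _)).
have [q1 q1Z eQ1] := @bin_shift_cong p (4 * m + 1) m pp ltac:(lia).
have [q3 q3Z eQ3] := @bin_shift_cong p (4 * m + 1) (3 * m + 1) pp ltac:(lia).
have bsym : 'C(4 * m + 1, 3 * m + 1) = 'C(4 * m + 1, m).
  by rewrite -bin_sub; [congr 'C(_, _)|]; lia.
rewrite bsym in eQ3.
have hpE : (4 * m + 1 + p)%:R = d / 2%:R :> rat.
  by rewrite (natrD _ (4 * m + 1)) (natrD _ (4 * m)) (natrM _ 4) mR /d; field.
have n12 : (4 * m + 1 + p).-1 = (12 * m + 3)%N by lia.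
have XE : X%:R = (p%:R - 3%:R) / (4%:R * d) * 'C(4 * m + 1 + p, m)%:R.
  have : ((4 * m + 1 + p) * X = m * 'C(4 * m + 1 + p, m))%N.
    have [m0|m0] := posnP m; first by rewrite eX m0 bin_small ?muln0.
    have := mul_bin_diag (4 * m + 1 + p) m.-1; rewrite prednK // n12 => <-.
    by rewrite eX -bin_sub; [congr (_ * 'C(_, _))%N|]; lia.
  move/(congr1 (fun n => n%:R : rat)); rewrite !natrM hpE mR => e.
  apply: (@mulfI _ (d / 2%:R)); first by rewrite mulf_neq0.
  by rewrite e; field.
have YE : Y%:R = 1 / 4%:R * 'C(4 * m + 1 + p, 3 * m + 1)%:R :> rat.
  have : ((4 * m + 1 + p) * Y = (3 * m + 1) * 'C(4 * m + 1 + p, 3 * m + 1))%N.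
    by rewrite [(3 * m + 1)%N]addn1 -mul_bin_diag n12 eY.
  move/(congr1 (fun n => n%:R : rat)); rewrite !natrM hpE (natrD _ (3 * m)) (natrM _ 3) mR => e.
  apply: (@mulfI _ (d / 2%:R)); first by rewrite mulf_neq0.
  by rewrite e /d; field.
rewrite (_ : (4 * m + 1 - m = 3 * m + 1)%N) in eS; last by lia.
have CZ : 'C(4 * m + 1, m)%:R \in p_integral p by apply: rpred_nat.
rewrite /D XE YE eS eQ1 eQ3; move: ('C(4 * m + 1, m)%:R : rat) CZ => u uZ; split.
  exists (2%:R * s + d^-1 * (q1 * (p%:R - 11%:R) / 4%:R - 8%:R * u) + q3 / 4%:R).
    by p_integral_tac.
  by rewrite /d; field.
exists (2%:R * u / d - (p%:R - 3%:R) / (4%:R * d) * q1 - q3 / 4%:R).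
  by rewrite invfM; p_integral_tac.
by rewrite /d; field.
Qed.

(** The product (cb - da)(cb + da) is p (b^2 - d^2), so p divides one factor.
    As p^2 = (ca + 2db)^2 + 2 (cb - da)^2, that factor vanishes. *)
Lemma two_square_unique p (a b c d : int) : prime p ->
  p%:Z = a ^+ 2 + 2 * b ^+ 2 -> p%:Z = c ^+ 2 + 2 * d ^+ 2 -> a ^+ 2 = c ^+ 2.
Proof.
move=> pp ab cd.
have p0 : p%:Z != 0 by have := prime_gt0 pp; lia.
have prod0 (b' : int) : b' ^+ 2 = b ^+ 2 -> (p%:Z %| c * b' - d * a)%Z -> c * b' - d * a = 0.
  move=> bb /dvdzP[t et].
  have e : p%:Z ^+ 2 = (c * a + 2 * d * b') ^+ 2 + 2 * (c * b' - d * a) ^+ 2.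
    by rewrite expr2 {1}ab cd -bb; ring.
  have t0 : t ^+ 2 = 0.
    move: e; rewrite et; have := sqr_ge0 (c * a + 2 * d * b'); have := sqr_ge0 t.
    have : 0 < p%:Z ^+ 2 by rewrite exprn_gt0 // ltz_nat prime_gt0.
    rewrite exprMn; move: (t ^+ 2 : int) (p%:Z ^+ 2 : int) ((c * a + _) ^+ 2 : int).
    move=> T P Q P0 T0 Q0 eP.
    apply/eqP; rewrite eq_le T0 andbT leNgt; apply/negP => T1.
    have : P <= T * P by apply: ler_peMl; lia.
    by lia.
  by have /eqP := t0; rewrite expf_eq0 /= => /eqP t00; rewrite et t00 mul0r.
have fact : (c * b - d * a) * (c * b + d * a) = p%:Z * (b ^+ 2 - d ^+ 2).
  rewrite mulrBr {1}cd ab; ring.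
have : (c * b - d * a) * (c * b + d * a) = 0.
  have : (p%:Z %| (c * b - d * a) * (c * b + d * a))%Z by rewrite fact dvdz_mulr.
  rewrite dvdzE abszM Euclid_dvdM // => /orP[H|H].
    by rewrite (prod0 b (erefl _)) ?mul0r // dvdzE.
  have e : c * b + d * a = - (c * - b - d * a) by ring.
  by rewrite [X in _ * X]e (prod0 (- b)) ?sqrrN ?oppr0 ?mulr0 // -rpredN -e dvdzE.
rewrite fact => /eqP; rewrite mulf_eq0 (negPf p0) /= subr_eq0 => /eqP bd.
by apply: (addIr (2 * b ^+ 2)); rewrite -ab cd bd.
Qed.

(** * Extracting coefficients with roots of unity *)
Section RootsOfUnity.
Variables (R : comNzRingType) (u : R) (n : nat).
Hypothesis un : u ^+ n = 1.
Hypothesis ureg : forall j, ~~ (n %| j)%N -> GRing.lreg (u ^+ j - 1).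

Lemma sum_unity_powers j :
  \sum_(k < n) u ^+ (k * j) = if (n %| j)%N then n%:R else 0.
Proof.
case: ifPn => [/dvdnP[t ->]|nj].
  rewrite (eq_bigr (fun=> 1)) ?sumr_const ?card_ord // => k _.
  by rewrite mulnA mulnC exprM un expr1n.
apply: (ureg nj); rewrite mulr0.
under eq_bigr => k _ do rewrite mulnC exprM.
by rewrite -subrX1 -exprM mulnC exprM un expr1n subrr.
Qed.

Lemma unity_half w : n = (4 * w)%N -> (0 < w)%N -> u ^+ (2 * w) = -1.
Proof.
move=> nw w0; apply/eqP; rewrite -subr_eq0 opprK; apply/eqP.
apply: (@ureg (2 * w)); first by rewrite nw; apply/negP => /dvdn_leq; lia.
by rewrite mulr0 -subr_sqr expr1n -exprM (_ : (2 * w * 2 = n)%N) ?un ?subrr //; lia.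
Qed.

(** Here u^(n-1) is the inverse of u and (-1)^k is u^(2wk), so the summand is a
    Laurent polynomial in u^k, and summing over k keeps the exponents that are
    multiples of n. *)
Lemma twisted_power_sum w M : n = (4 * w)%N -> (0 < w)%N ->
  \sum_(k < n) (-1) ^+ k * (u ^+ (2 * k) + u ^+ (n.-1 * (2 * k))) ^+ M =
  n%:R * (\sum_(i < M.+1 | n %| 2 * w + 2 * n.-1 * (M - i) + 2 * i) 'C(M, i))%N%:R.
Proof.
move=> nw w0; rewrite natr_sum mulr_sumr.
transitivity (\sum_(i < M.+1) 'C(M, i)%:R *
   \sum_(k < n) u ^+ (k * (2 * w + 2 * n.-1 * (M - i) + 2 * i))).
  under [RHS]eq_bigr => i _ do rewrite mulr_sumr.
  rewrite exchange_big; apply: eq_bigr => k _ /=.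
  rewrite -(unity_half nw w0) addrC exprDn mulr_sumr; apply: eq_bigr => i _.
  rewrite -!exprM -!exprD mulrnAr -exprD -mulr_natl; congr (_ * u ^+ _); lia.
rewrite [RHS]big_mkcond; apply: eq_bigr => i _.
by rewrite sum_unity_powers; case: ifP; rewrite ?mulr0 // mulrC.
Qed.
End RootsOfUnity.

Lemma big_nat_residue L w r (F : nat -> nat) : (r < w)%N ->
  (\sum_(0 <= i < L * w | i %% w == r) F i = \sum_(0 <= j < L) F (j * w + r))%N.
Proof.
move=> rw; elim: L => [|L IHL]; first by rewrite !big_geq.
rewrite (@big_cat_nat _ _ _ (L * w)) ?leq_mul2r ?leqnSn ?orbT //= IHL big_nat_recr //=.
congr (_ + _)%N; rewrite -{1}[(L * w)%N]add0n big_addn mulSn addnK big_mkord.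
rewrite (big_pred1 (Ordinal rw)) /= 1?addnC // => i.
by rewrite /= addnC modnMDl modn_small.
Qed.

Lemma sum_bin_residue M L w r (P : pred nat) : (r < w)%N -> (M < L * w)%N ->
  (forall i, (i <= M)%N -> P i = (i %% w == r)%N) ->
  (\sum_(i < M.+1 | P i) 'C(M, i) = \sum_(0 <= j < L) 'C(M, j * w + r))%N.
Proof.
move=> rw ML HP; rewrite -big_nat_residue // (@big_cat_nat _ _ _ M.+1) //=.
rewrite [X in (_ + X)%N]big1_seq ?addn0 => [|i]; last first.
  by rewrite mem_index_iota => /and3P[_ Mi _]; rewrite bin_small.
by rewrite big_mkord; apply: eq_bigl => i; rewrite HP // -ltnS.
Qed.

Lemma dvdn_add_residue w r i : (r < w)%N -> (w %| i + (w - r))%N = (i %% w == r)%N.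
Proof.
move=> rw; rewrite {1}(divn_eq i w) -addnA dvdn_addr ?dvdn_mull //.
have := ltn_pmod i (leq_ltn_trans (leq0n r) rw); move: (i %% w)%N => s sw.
apply/idP/eqP => [/dvdnP[t]|->]; last by rewrite subnKC // ltnW.
by case: t => [|[|t]]; rewrite ?mulSn; lia.
Qed.

(** On the subfield with p = 2h + 1 elements this is the quadratic character;
    allowing a larger field lets it be applied to traces without coercing them
    to the prime field. *)
Definition qchar (F : fieldType) h (x : F) : int :=
  if x ^+ h == 1 then 1 else if x ^+ h == -1 then -1 else 0.

Section QChar.
Variables (F : fieldType) (p h : nat).
Hypotheses (pp : prime p) (chp : p \in [pchar F]) (ph : p = (2 * h).+1).
Notation chi := (@qchar F h).

Lemma natr2_neq0 : 2%:R != 0 :> F.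
Proof.
by rewrite -(dvdn_pcharf chp); apply/negP => /dvdn_leq; have := prime_gt1 pp; lia.
Qed.

Lemma oppr1_neq1 : (1 == -1 :> F) = false.
Proof. by rewrite -subr_eq0 opprK -[1 + 1]/(2%:R) (negPf natr2_neq0). Qed.

Lemma qcharP x : x ^+ p = x ->
  [\/ x = 0 /\ chi x = 0, x ^+ h = 1 /\ chi x = 1 | x ^+ h = -1 /\ chi x = -1].
Proof.
move=> xp; rewrite /qchar; have h0 : (0 < h)%N by have := prime_gt1 pp; lia.
have [->|x0] := eqVneq x 0.
  constructor 1; rewrite expr0n (gtn_eqF h0) eq_sym oner_eq0 eq_sym oppr_eq0 oner_eq0 //.
have : (x ^+ h - 1) * (x ^+ h + 1) == 0.
  apply/eqP; apply: (mulfI x0); rewrite mulr0 -subr_sqr expr1n -exprM mulrBr mulr1.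
  by rewrite -exprS (_ : (h * 2).+1 = p) ?xp ?subrr // ph mulnC.
rewrite mulf_eq0 subr_eq0 addr_eq0 => /orP[/eqP e|/eqP e]; rewrite e.
  by constructor 2; rewrite eqxx.
by constructor 3; rewrite eq_sym oppr1_neq1 eqxx.
Qed.

Lemma exp0_half : 0 ^+ h = 0 :> F.
Proof. by rewrite expr0n; case: (h) ph pp => [->|]. Qed.

Lemma qchar0 : chi 0 = 0.
Proof. by rewrite /qchar exp0_half eq_sym oner_eq0 eq_sym oppr_eq0 oner_eq0. Qed.

Lemma qchar1 : chi 1 = 1.
Proof. by rewrite /qchar expr1n eqxx. Qed.

Lemma qcharM x y : x ^+ p = x -> chi (x * y) = chi x * chi y.
Proof.
move=> /qcharP[[-> ->]|[e ->]|[e ->]]; first by rewrite mul0r qchar0 mul0r.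
  by rewrite /qchar exprMn e !mul1r.
rewrite /qchar exprMn e !mulN1r eqr_oppLR eqr_opp.
case: ifPn => [/eqP->|ne]; first by rewrite eq_sym oppr1_neq1.
by case: ifP => // _; rewrite oppr0.
Qed.

Lemma qchar_eq0 x : x ^+ p = x -> (chi x == 0) = (x == 0).
Proof.
have unit_neq0 (e : F) : e != 0 -> x ^+ h = e -> (x == 0) = false.
  by move=> e0 xe; apply: contraNF e0 => /eqP x0; rewrite -xe x0 exp0_half.
case/qcharP=> [[-> ->]|[e ->]|[e ->]]; first by rewrite !eqxx.
  by rewrite (unit_neq0 _ _ e) ?oner_eq0.
by rewrite (unit_neq0 _ _ e) ?oppr_eq0 ?oner_eq0.
Qed.

Lemma qchar_sqr x : x ^+ p = x -> chi x ^+ 2 = (x != 0)%:R.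
Proof.
move=> xp; rewrite -(qchar_eq0 xp).
by have [[_ ->]|[_ ->]|[_ ->]] := qcharP xp.
Qed.

Lemma intr_exp_p (z : int) : (z%:~R : F) ^+ p = z%:~R.
Proof. by rewrite -(pFrobenius_autE chp) rmorph_int. Qed.

(** If z is prime to p then z^h = chi(z) (1 + p t) modulo p^2, and the weights 3
    and -1 annihilate the term in t, since z^(3h) = chi(z) (1 + 3 p t). *)
Lemma qchar_lift (z : int) : (1 < h)%N ->
  exists k : int, 3 * z ^+ h - z ^+ (3 * h) = 2 * chi z%:~R + p%:Z ^+ 2 * k.
Proof.
move=> h1; have dvd (y : int) : y%:~R = 0 :> F -> exists t : int, y = p%:Z * t.
  move/eqP; rewrite -(dvdz_pcharf chp) => /dvdzP[t ->]; exists t; exact: mulrC.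
have [[z0 ->]|[z1 ->]|[z1 ->]] := qcharP (intr_exp_p z).
- have [t et] := dvd _ z0; pose s := p%:Z ^+ (h - 2) * t ^+ h.
  have zh : z ^+ h = p%:Z ^+ 2 * s.
    by rewrite et exprMn mulrA -exprD subnKC.
  by exists (3 * s - s * z ^+ (2 * h)); rewrite mulSn exprD zh; ring.
- have [|t et] := dvd (z ^+ h - 1).
    by rewrite rmorphB rmorphXn /= z1 subrr.
  exists (- 3 * t ^+ 2 - p%:Z * t ^+ 3).
  rewrite mulnC exprM (_ : z ^+ h = 1 + p%:Z * t); first by ring.
  by rewrite -et; ring.
have [|t et] := dvd (z ^+ h + 1).
  by rewrite rmorphD rmorphXn /= z1 addNr.
exists (3 * t ^+ 2 - p%:Z * t ^+ 3).
rewrite mulnC exprM (_ : z ^+ h = - 1 + p%:Z * t); first by ring.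
by rewrite -et; ring.
Qed.
End QChar.

(** The character is replaced by powers of the integers [y k], whose sum is
    computed in [R], where they become u^(2k) + u^(-2k). Seven blocks of length
    [w] cover all indices up to 3h. *)
Lemma character_sum_mod_p2 (F : fieldType) (R : comNzRingType) p h (u : R) n w
    (y : nat -> int) r1 r3 :
    prime p -> p \in [pchar F] -> p = (2 * h).+1 -> (1 < h)%N ->
    (forall z : int, z%:~R = 0 :> R -> (p%:Z ^+ 2 %| z)%Z) ->
    n = (4 * w)%N -> (r1 < w)%N -> (r3 < w)%N -> (3 * h < 7 * w)%N ->
    u ^+ n = 1 -> (forall j, ~~ (n %| j)%N -> GRing.lreg (u ^+ j - 1)) ->
    (forall k, (y k)%:~R = u ^+ (2 * k) + u ^+ (n.-1 * (2 * k))) ->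
    (forall i, (i <= h)%N ->
      (n %| 2 * w + 2 * n.-1 * (h - i) + 2 * i)%N = (i %% w == r1)%N) ->
    (forall i, (i <= 3 * h)%N ->
      (n %| 2 * w + 2 * n.-1 * (3 * h - i) + 2 * i)%N = (i %% w == r3)%N) ->
  exists K : int, 2 * (\sum_(k < n) (-1) ^+ k * qchar h ((y k)%:~R : F)) =
    n%:Z * (3 * (\sum_(0 <= j < 7) 'C(h, j * w + r1))%N%:Z
            - (\sum_(0 <= j < 7) 'C(3 * h, j * w + r3))%N%:Z) + p%:Z ^+ 2 * K.
Proof.
move=> pp chp ph h1 hR nw r1w r3w hw un ureg yE c1 c3.
have w0 : (0 < w)%N by apply: leq_ltn_trans r1w.
pose E : int := n%:Z * (3 * (\sum_(0 <= j < 7) 'C(h, j * w + r1))%N%:Z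
            - (\sum_(0 <= j < 7) 'C(3 * h, j * w + r3))%N%:Z).
pose P : int := \sum_(k < n) (-1) ^+ k * (3 * y k ^+ h - y k ^+ (3 * h)).
have PE : (p%:Z ^+ 2 %| P - E)%Z.
  apply: hR; rewrite rmorphB /=; apply/eqP; rewrite subr_eq0; apply/eqP.
  have S1 := twisted_power_sum un ureg h nw w0.
  have S3 := twisted_power_sum un ureg (3 * h) nw w0.
  rewrite (@sum_bin_residue h 7 w r1 _ r1w _ c1) in S1; last first.
    by apply: leq_ltn_trans hw; rewrite leq_pmull.
  rewrite (sum_bin_residue r3w hw c3) in S3.
  rewrite /P /E rmorph_sum /= rmorphM rmorphB rmorphM /= mulrBr mulrCA -!pmulrn.
  rewrite -S1 -S3 mulr_sumr -sumrB; apply: eq_bigr => k _.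
  by rewrite rmorphM rmorphB rmorphM !rmorphXn /= yE rmorphN1 -pmulrn; ring.
have PC : (p%:Z ^+ 2 %| P - 2 * (\sum_(k < n) (-1) ^+ k * qchar h ((y k)%:~R : F)))%Z.
  rewrite mulr_sumr -sumrB; apply: rpred_sum => k _.
  have [t et] := qchar_lift pp chp ph (y k) h1.
  apply/dvdzP; exists ((-1) ^+ k * t); rewrite et; ring.
have : (p%:Z ^+ 2 %| (P - E) - (P - 2 * (\sum_(k < n) (-1) ^+ k * qchar h ((y k)%:~R : F))))%Z.
  by rewrite rpredB.
case/dvdzP=> K eK; exists K; rewrite -/E [_ * K]mulrC -eK; ring.
Qed.

(** The second moment consists of E copies of B(0)^2 + ... + B(3)^2. *)
Lemma two_squares_of_period4 (B : nat -> int) p E : (0 < E)%N ->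
    (forall e, B (e + 4)%N = - B e) -> B 2%N = 0 -> B 3%N ^+ 2 = B 1%N ^+ 2 ->
    \sum_(e < 4 * E) B e ^+ 2 = E%:Z * p%:Z ->
  p%:Z = B 0%N ^+ 2 + 2 * B 1%N ^+ 2.
Proof.
move=> E0 B4 B2 B3; have -> : \sum_(e < 4 * E) B e ^+ 2 =
    E%:Z * (B 0%N ^+ 2 + B 1%N ^+ 2 + B 2%N ^+ 2 + B 3%N ^+ 2).
  rewrite -(big_mkord xpredT (fun e => B e ^+ 2)) mulnC; elim: E {E0} => [|E IHE].
    by rewrite big_geq // mul0r.
  rewrite mulSn addnC (@big_cat_nat _ _ _ (E * 4)) ?leq_addr //= IHE.
  have per e j : B (j + e * 4)%N ^+ 2 = B j ^+ 2.
    by elim: e => [|e IHe]; rewrite ?addn0 // mulSn addnCA addnC B4 sqrrN.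
  rewrite -{1}[(E * 4)%N]add0n big_addn addKn !big_nat_recl // big_geq // !per -[E.+1]addn1 PoszD.
  by ring.
have En0 : E%:Z != 0 by rewrite eqz_nat -lt0n.
by move/(mulfI En0) => <-; rewrite B2 B3 expr0n /=; ring.
Qed.

Lemma sum_periodic_shift (f : nat -> int) w : (forall k, f (k + w)%N = f k) ->
  \sum_(k < w) f k.+1 = \sum_(k < w) f k.
Proof.
move=> per; case: w per => [|w] per; first by rewrite !big_ord0.
by rewrite big_ord_recr [RHS]big_ord_recl addrC /= -(per 0%N) add0n.
Qed.

Lemma sum_periodic_mul (f : nat -> int) w q : (forall k, f (k + w)%N = f k) ->
  \sum_(k < q * w) f k = q%:Z * \sum_(k < w) f k.
Proof.
move=> per; rewrite -!(big_mkord xpredT f); elim: q => [|q IHq].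
  by rewrite big_geq // mul0r.
rewrite mulSn addnC (@big_cat_nat _ _ _ (q * w)) ?leq_addr //= IHq.
rewrite -{1}[(q * w)%N]add0n big_addn addKn -addn1 PoszD mulrDl mul1r; congr (_ + _).
apply: eq_bigr => k _; elim: q {IHq} => [|q IHq]; first by rewrite addn0.
by rewrite mulSn addnCA addnC per.
Qed.

Lemma sum_reverse (f g : nat -> int) w : (forall k, f (k + w)%N = f k) ->
  (forall k, (k <= w)%N -> g k = f (w - k)%N) ->
  \sum_(k < w) g k = \sum_(k < w) f k.
Proof.
move=> per gf; rewrite -(sum_periodic_shift per) (reindex_inj rev_ord_inj).
apply: eq_bigr => k _; rewrite gf /=; last by rewrite leq_subr.
by congr f; have := ltn_ord k; lia.
Qed.

(** The terms are 1 or -1, and 2 = -2 modulo 4. *)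
Lemma sum_odd_mod4 (f : nat -> int) a b : (a <= b)%N ->
  (forall k, (a <= k < b)%N -> f k ^+ 2 = 1) ->
  exists t : int, 2 * \sum_(a <= k < b) f k = 2 * (b - a)%N%:Z + 4 * t.
Proof.
elim: b => [|b IHb] ab f1; first by exists 0; rewrite big_geq // (eqP (ab : a - 0 == 0)%N).
move: ab; rewrite leq_eqVlt => /orP[/eqP<-|ab]; first by exists 0; rewrite big_geq // subnn.
have [k /andP[ak kb]|t et] := IHb ab; first by apply: f1; rewrite ak ltnW.
have : f b ^+ 2 == 1 by apply/eqP/f1; rewrite ltnSn andbT -ltnS.
rewrite big_nat_recr //= mulrDr et subSn // intS.
rewrite sqrf_eq1 => /orP[]/eqP->; [exists t|exists (t - 1)]; ring.
Qed.

Lemma sum_symmetric_even (f : nat -> int) m : (0 < m)%N ->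
  (forall k, (0 < k < 2 * m)%N -> f (2 * m - k)%N = f k) ->
  \sum_(k < 2 * m) f k = f 0%N + f m + 2 * \sum_(1 <= k < m) f k.
Proof.
move=> m0 sym; rewrite -(big_mkord xpredT f) big_ltn ?muln_gt0 //.
rewrite (@big_cat_nat _ _ _ m) //=; last by lia.
rewrite [X in _ + (_ + X)]big_ltn; last by lia.
have -> : \sum_(m.+1 <= k < 2 * m) f k = \sum_(1 <= k < m) f k.
  rewrite big_nat_rev /= -{1}[m.+1]add1n (big_addn 1 _ m) (_ : 2 * m - m = m)%N; last by lia.
  apply: eq_big_nat => k /andP[k0 km]; rewrite -sym; last by lia.
  by congr f; lia.
ring.
Qed.

Lemma sum_symmetric_odd (f : nat -> int) m :
  (forall k, (0 < k <= 2 * m)%N -> f ((2 * m).+1 - k)%N = f k) ->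
  \sum_(k < (2 * m).+1) f k = f 0%N + 2 * \sum_(1 <= k < m.+1) f k.
Proof.
move=> sym; rewrite -(big_mkord xpredT f) big_ltn //.
rewrite (@big_cat_nat _ _ _ m.+1) //=; last by lia.
have -> : \sum_(m.+1 <= k < (2 * m).+1) f k = \sum_(1 <= k < m.+1) f k.
  rewrite big_nat_rev /= -{1}[m.+1]add1n (big_addn 1 _ m).
  rewrite (_ : (2 * m).+1 - m = m.+1)%N; last by lia.
  apply: eq_big_nat => k /andP[k0 km]; rewrite -sym; last by lia.
  by congr f; lia.
ring.
Qed.

(** * Arithmetic in rings where p^2 = 0 *)
(** Hence the p-th power of any lift of a root of unity is a root of unity
    modulo p^2. *)
Lemma expr_1Dp (R : comNzRingType) p (x : R) : p%:R ^+ 2 = 0 :> R -> (1 + p%:R * x) ^+ p = 1.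
Proof.
move=> p2; have E n : (1 + p%:R * x) ^+ n = 1 + n%:R * (p%:R * x).
  elim: n => [|n IHn]; first by rewrite mul0r addr0.
  rewrite exprS IHn -natr1.
  transitivity (1 + (n%:R + 1) * (p%:R * x) + n%:R * x ^+ 2 * p%:R ^+ 2); first by ring.
  by rewrite p2 mulr0 addr0.
by rewrite E mulrA -expr2 p2 mul0r addr0.
Qed.

(** Bezout's identity for z and p^2, read in [R]. *)
Lemma inverse_mod_p2 (R : comNzRingType) p (z : int) : prime p -> p%:R ^+ 2 = 0 :> R ->
  ~~ (p%:Z %| z)%Z -> exists z' : int, z'%:~R * z%:~R = 1 :> R.
Proof.
move=> pp p2 zp; have /coprimezP[[a b] /= e] : coprimez z (p%:Z ^+ 2).
  by rewrite coprimezE abszX absz_nat coprimeXr // coprime_sym prime_coprime.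
exists a; have := congr1 (fun z : int => z%:~R : R) e.
have pz : (p%:Z ^+ 2)%:~R = 0 :> R by rewrite rmorphXn.
by rewrite intrD (intrM _ a) (intrM _ b) pz mulr0 addr0.
Qed.

Lemma lreg_of_mul_unit (R : comNzRingType) (x y z : R) : z * (y * x) = 1 -> GRing.lreg x.
Proof.
move=> e a b ab; rewrite -[a]mul1r -[b]mul1r -e -!mulrA; congr (_ * (_ * _)); exact: ab.
Qed.

Lemma intr_Zp_eq0 n (z : int) : (1 < n)%N -> z%:~R = 0 :> 'Z_n -> (n%:Z %| z)%Z.
Proof.
move=> n1; have nat0 k : k%:R = 0 :> 'Z_n -> (n %| k)%N.
  by move/(congr1 val); rewrite /= val_Zp_nat // => /eqP.
case: z => k; first by move/nat0.
by rewrite NegzE mulrNz => /eqP; rewrite oppr_eq0 => /eqP/nat0.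
Qed.

Lemma dvdn_eq_shift n a b s t : (a + n * s = b + n * t)%N -> (n %| a)%N = (n %| b)%N.
Proof.
move=> e; transitivity (n %| a + n * s)%N; first by rewrite dvdn_addl ?dvdn_mulr.
by rewrite e dvdn_addl ?dvdn_mulr.
Qed.

Lemma mul_pred n D : (0 < n)%N -> (n.-1 * D + D = n * D)%N.
Proof. by move=> n0; rewrite addnC -mulSn prednK. Qed.

Lemma halve_mod_p2 p (a b K : int) : odd p -> 2 * a = 2 * b + p%:Z ^+ 2 * K ->
  exists K' : int, a = b + p%:Z ^+ 2 * K'.
Proof.
move=> p_odd e; have : (p%:Z ^+ 2 %| a - b)%Z.
  rewrite -(@Gauss_dvdzr _ 2); last by rewrite coprimezE abszX coprimeXl // coprimen2.
  by apply/dvdzP; exists K; rewrite mulrBr e addrC addKr mulrC.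
by case/dvdzP=> K' /(canRL (subrK _)) ->; exists K'; rewrite addrC mulrC.
Qed.

Lemma sum_nat7 (f : nat -> nat) :
  (\sum_(0 <= j < 7) f j = f 0 + f 1 + f 2 + f 3 + f 4 + f 5 + f 6)%N.
Proof. by rewrite !big_nat_recl // big_geq // addn0 !addnA. Qed.

(** The indices of these sums are symmetric under reflection, so every binomial
    coefficient occurs twice. *)
Lemma split_binomials m : (0 < m)%N ->
  (\sum_(0 <= j < 7) 'C(4 * m, j * (2 * m) + m) = 2 * 'C(4 * m, m))%N /\
  (\sum_(0 <= j < 7) 'C(3 * (4 * m), j * (2 * m) + m) =
           2 * ('C(12 * m, m) + 'C(12 * m, 3 * m) + 'C(12 * m, 5 * m)))%N.
Proof.
move=> m0; have sm n k : (n < k)%N -> 'C(n, k) = 0%N by apply: bin_small.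
have sym n k l : (k + l = n)%N -> 'C(n, k) = 'C(n, l).
  by move=> e; rewrite -bin_sub; [congr 'C(_, _)|]; lia.
rewrite !sum_nat7 (_ : 3 * (4 * m) = 12 * m)%N; last by lia.
rewrite (sm (4 * m)%N (2 * (2 * m) + m)%N); last by lia.
rewrite (sm (4 * m)%N (3 * (2 * m) + m)%N); last by lia.
rewrite (sm (4 * m)%N (4 * (2 * m) + m)%N); last by lia.
rewrite (sm (4 * m)%N (5 * (2 * m) + m)%N); last by lia.
rewrite (sm (4 * m)%N (6 * (2 * m) + m)%N); last by lia.
rewrite (sm (12 * m)%N (6 * (2 * m) + m)%N); last by lia.
rewrite (sym (4 * m)%N (1 * (2 * m) + m)%N m); last by lia.
rewrite (sym (12 * m)%N (5 * (2 * m) + m)%N m); last by lia.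
rewrite (sym (12 * m)%N (4 * (2 * m) + m)%N (3 * m)%N); last by lia.
rewrite (sym (12 * m)%N (3 * (2 * m) + m)%N (5 * m)%N); last by lia.
rewrite !mul0n !add0n (_ : 1 * (2 * m) + m = 3 * m)%N; last by lia.
rewrite (_ : 2 * (2 * m) + m = 5 * m)%N; lia.
Qed.

Lemma inert_binomials m : (0 < m)%N ->
  (\sum_(0 <= j < 7) 'C(4 * m + 1, j * (2 * m + 1) + m) = 2 * 'C(4 * m + 1, m))%N /\
  (\sum_(0 <= j < 7) 'C(3 * (4 * m + 1), j * (2 * m + 1) + m.-1) =
           2 * ('C(12 * m + 3, 11 * m + 4) + 'C(12 * m + 3, 3 * m) + 'C(12 * m + 3, 5 * m + 1)))%N.
Proof.
move=> m0; have sm n k : (n < k)%N -> 'C(n, k) = 0%N by apply: bin_small.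
have sym n k l : (k + l = n)%N -> 'C(n, k) = 'C(n, l).
  by move=> e; rewrite -bin_sub; [congr 'C(_, _)|]; lia.
rewrite !sum_nat7 (_ : 3 * (4 * m + 1) = 12 * m + 3)%N; last by lia.
rewrite (sm (4 * m + 1)%N (2 * (2 * m + 1) + m)%N); last by lia.
rewrite (sm (4 * m + 1)%N (3 * (2 * m + 1) + m)%N); last by lia.
rewrite (sm (4 * m + 1)%N (4 * (2 * m + 1) + m)%N); last by lia.
rewrite (sm (4 * m + 1)%N (5 * (2 * m + 1) + m)%N); last by lia.
rewrite (sm (4 * m + 1)%N (6 * (2 * m + 1) + m)%N); last by lia.
rewrite (sm (12 * m + 3)%N (6 * (2 * m + 1) + m.-1)%N); last by lia.
rewrite (sym (4 * m + 1)%N (1 * (2 * m + 1) + m)%N m); last by lia.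
rewrite (sym (12 * m + 3)%N (0 * (2 * m + 1) + m.-1)%N (11 * m + 4)%N); last by lia.
rewrite (sym (12 * m + 3)%N (4 * (2 * m + 1) + m.-1)%N (3 * m)%N); last by lia.
rewrite (sym (12 * m + 3)%N (3 * (2 * m + 1) + m.-1)%N (5 * m + 1)%N); last by lia.
rewrite !mul0n !add0n (_ : 1 * (2 * m + 1) + m.-1 = 3 * m)%N; last by lia.
rewrite (_ : 5 * (2 * m + 1) + m.-1 = 11 * m + 4)%N; last by lia.
rewrite (_ : 2 * (2 * m + 1) + m.-1 = 5 * m + 1)%N; lia.
Qed.

Lemma split_residue m a i : (0 < m)%N -> (i <= a * (4 * m))%N ->
  (8 * m %| 2 * (2 * m) + 2 * (8 * m).-1 * (a * (4 * m) - i) + 2 * i)%N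
    = (i %% (2 * m) == m)%N.
Proof.
move=> m0 /subnKC; set D := (_ - i)%N => eD; rewrite -dvdn_add_residue; last by lia.
rewrite -[RHS](@dvdn_pmul2l 4) // (mulnA 4 2 m) -[(4 * 2)%N]/8%N.
apply: (@dvdn_eq_shift _ _ _ a (2 * D)).
have := @mul_pred (8 * m) D; rewrite muln_gt0 m0 => /(_ isT).
by rewrite -(mulnA 2%N (8 * m).-1 D); move: ((8 * m).-1 * D)%N eD => c; lia.
Qed.

Lemma inert_residue m p a r i : p = (8 * m + 3)%N -> (r <= m)%N ->
    (2 * r + a = 2 * m + 1)%N -> (i <= a * (4 * m + 1))%N ->
  (p.+1 %| 2 * (2 * m).+1 + 2 * p * (a * (4 * m + 1) - i) + 2 * i)%N
    = (i %% (2 * m).+1 == r)%N.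
Proof.
move=> pm rm ra /subnKC; set D := (_ - i)%N => eD.
rewrite -dvdn_add_residue; last by lia.
rewrite -[RHS](@dvdn_pmul2l 4) // (_ : 4 * (2 * m).+1 = p.+1)%N; last by lia.
apply: (@dvdn_eq_shift _ _ _ a (2 * D)).
have -> : (p.+1 * (2 * D) = 2 * D + 2 * (p * D))%N by rewrite mulSn mulnCA.
by rewrite -(mulnA 2%N p D); move: (p * D)%N => P; rewrite pm; lia.
Qed.

(** * Character sums for p = 1 modulo 8 *)
Lemma finField_primitive_root (F : finFieldType) :
  exists g : F, #|F|.-1.-primitive_root g.
Proof.
have F1 := finNzRing_gt1 F.
have /hasP[g _ gP] : has #|F|.-1.-primitive_root (enum (predC1 (0 : F))).
  apply: has_prim_root; rewrite ?enum_uniq -?cardE ?cardC1 -?subn1 ?subn_gt0 //.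
  apply/allP => x; rewrite mem_enum inE subn1 => x0.
  by apply/unity_rootP/(mulfI x0); rewrite mulr1 -exprS prednK ?expf_card // ltnW.
by exists g.
Qed.

Section PrimitiveRoot.
Variables (F : finFieldType) (g : F).
Hypothesis gP : #|F|.-1.-primitive_root g.

Lemma primitive_root_neq0 : g != 0.
Proof.
apply/eqP => g0; have /eqP := prim_expr_order gP.
by rewrite g0 expr0n (gtn_eqF (prim_order_gt0 gP)) eq_sym oner_eq0.
Qed.

Lemma sum_primitive_powers (f : F -> int) :
  \sum_(e < #|F|.-1) f (g ^+ e) = \sum_(x | x != 0) f x.
Proof.
pose s := [seq g ^+ (e : 'I_#|F|.-1) | e <- index_enum 'I_#|F|.-1].
have -> : \sum_(e < #|F|.-1) f (g ^+ e) = \sum_(x <- s) f x by rewrite big_map.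
rewrite -[RHS]big_filter; apply: perm_big; apply: uniq_perm.
- rewrite map_inj_in_uniq ?index_enum_uniq // => i j _ _ /eqP.
  by rewrite (eq_prim_root_expr gP) !modn_small // => /eqP/val_inj.
- by rewrite filter_uniq ?index_enum_uniq.
move=> x; rewrite mem_filter mem_index_enum andbT; apply/mapP/idP => [[e _ ->]|x0].
  by rewrite expf_neq0 ?primitive_root_neq0.
have [|i ->] := prim_rootP gP (x := x).
  apply: (mulfI x0); rewrite mulr1 -exprS prednK ?expf_card //.
  exact: ltnW (finNzRing_gt1 F).
by exists i; rewrite ?mem_index_enum.
Qed.
End PrimitiveRoot.

Section Split.
Variables (p m : nat) (pp : prime p) (pm : p = (8 * m).+1).
Let F : finFieldType := 'F_p.
Variable g : F.
Hypothesis gP : #|F|.-1.-primitive_root g.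
Let h := (4 * m)%N.
Notation chi := (@qchar F h).

Let m_gt0 : (0 < m)%N.
Proof. by have := prime_gt1 pp; rewrite pm; lia. Qed.
Let ph : p = (2 * h).+1. Proof. rewrite /h; lia. Qed.
Let chp : p \in [pchar F]. Proof. exact: pchar_Fp. Qed.
Let cardF : #|F|.-1 = (8 * m)%N. Proof. by rewrite /F card_Fp // pm. Qed.
Let gN : g ^+ (8 * m) = 1.
Proof. by rewrite -cardF (prim_expr_order gP). Qed.
Let g0 := primitive_root_neq0 gP.
Let xp (x : F) : x ^+ p = x.
Proof. by rewrite -{2}(expf_card x) /F card_Fp. Qed.
Let g_eq i j : (g ^+ i == g ^+ j) = (i == j %[mod 8 * m])%N.
Proof. by rewrite (eq_prim_root_expr gP) cardF. Qed.
Let ghalf : g ^+ (4 * m) = -1.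
Proof.
have : (g ^+ (4 * m)) ^+ 2 == 1 by rewrite -exprM (_ : 4 * m * 2 = 8 * m)%N ?gN //; lia.
rewrite sqrf_eq1 => /orP[|/eqP//].
by rewrite -[1](expr0 g) g_eq mod0n modn_small; lia.
Qed.

Let chiM x y : chi (x * y) = chi x * chi y. Proof. exact: (qcharM pp chp ph y (xp x)). Qed.
Let chiX k : chi (g ^+ k) = (-1) ^+ k.
Proof.
have chig : chi g = -1.
  by rewrite /qchar ghalf eq_sym (oppr1_neq1 pp chp ph) eqxx.
elim: k => [|k IHk]; first exact: qchar1.
by rewrite !exprS chiM IHk chig.
Qed.

Lemma sum_chi : \sum_x chi x = 0.
Proof.
have : \sum_x chi x = - \sum_x chi x.
  rewrite {1}(reindex_inj (mulfI g0)) /= -sumrN; apply: eq_bigr => x _.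
  by rewrite chiM -[g in chi g]expr1 chiX mulN1r.
lia.
Qed.

(** For b <> c the quadratic is moved to a (a + c - b), and a is replaced by its
    inverse: up to squares only a linear factor remains. *)
Lemma sum_chi_quadratic b c :
  \sum_a chi ((b + a) * (c + a)) = if b == c then p%:Z - 1 else -1.
Proof.
have [<-|bc] := eqVneq b c.
  transitivity (\sum_(a : F | a != 0) 1 : int).
    rewrite [RHS]big_mkcond [RHS](reindex_inj (addrI b)) /=; apply: eq_bigr => a _.
    by rewrite chiM -expr2 (qchar_sqr pp chp ph) //; case: (_ == 0).
  by rewrite sumr_const cardC1 cardF pm intS addrC addKr natz.
have d0 : c - b != 0 by rewrite subr_eq0 eq_sym.
rewrite (reindex_inj (addrI (- b))) /= (bigD1 0) //= addr0 subrr mul0r (qchar0 F pp ph) add0r.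
transitivity (\sum_(a | a != 0) chi (1 + (c - b) * a)); last first.
  have e : \sum_a chi (1 + (c - b) * a) = 0.
    by rewrite -[RHS]sum_chi [RHS](reindex_inj (addrI 1)) [RHS](reindex_inj (mulfI d0)).
  move: e; rewrite (bigD1 0) //= mulr0 addr0 qchar1 => /eqP.
  by rewrite addrC addr_eq0 => /eqP.
rewrite (reindex_inj invr_inj) /=; apply: eq_big => a; rewrite ?invr_eq0 // => a0.
have -> : (b + (- b + a^-1)) * (c + (- b + a^-1)) = (a^-1) ^+ 2 * (1 + (c - b) * a).
  by field.
rewrite chiM (_ : chi (_ ^+ 2) = 1) ?mul1r //.
by rewrite expr2 chiM -expr2 (qchar_sqr pp chp ph) // invr_eq0 a0.
Qed.

Let s4 : (-1) ^+ 4 = 1 :> int. Proof. by []. Qed.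

(** [W e k] is (-1)^k chi(g^(2k) + g^(e-2k)), multiplied out by the square
    g^(2k) in order to avoid negative exponents. *)
Let W e k : int := chi (g ^+ k) * chi (g ^+ (4 * k) + g ^+ e).
Let B e : int := \sum_(k < 2 * m) W e k.

Let W_period e k : W e (k + 2 * m) = W e k.
Proof.
rewrite /W (mulnDr 4 k) (exprD g k) (exprD g (4 * k)) (_ : 4 * (2 * m) = 8 * m)%N; last by lia.
by rewrite gN mulr1 chiM [chi (g ^+ (2 * m))]chiX exprM sqrrN !expr1n mulr1.
Qed.

Let B_add4 e : B (e + 4) = - B e.
Proof.
rewrite /B -(sum_periodic_shift (W_period _)) -sumrN; apply: eq_bigr => k _.
rewrite /W mulnS (addnC e) (exprD g 4 (4 * k)) (exprD g 4 e) -mulrDr chiM !chiX exprS.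
by rewrite s4; ring.
Qed.

(** The substitution k -> - k exchanges g^(2k) + g^(e-2k) with
    g^e (g^(2k) + g^(-e-2k)). *)
Let W_reflect e k : (e <= 8 * m)%N -> (k <= 2 * m)%N ->
  W (8 * m - e) (2 * m - k) = (-1) ^+ e * W e k.
Proof.
move=> eN kw; have sq n : (-1) ^+ n * (-1) ^+ n = 1 :> int by rewrite -expr2 sqrr_sign.
have c1 : (-1) ^+ (2 * m - k) = (-1) ^+ k :> int.
  by rewrite -signr_odd oddB // mul2n odd_double /= signr_odd.
rewrite /W !chiX c1 mulrCA; congr (_ * _).
have e1 : g ^+ (4 * k + e) * (g ^+ (4 * (2 * m - k)) + g ^+ (8 * m - e)) = g ^+ (4 * k) + g ^+ e.
  rewrite mulrDr -(exprD g _ (4 * (2 * m - k))) -(exprD g _ (8 * m - e)).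
  rewrite (_ : 4 * k + e + _ = 8 * m + e)%N; last by lia.
  rewrite (_ : 4 * k + e + _ = 8 * m + 4 * k)%N; last by lia.
  by rewrite (exprD g (8 * m) e) (exprD g (8 * m) (4 * k)) gN !mul1r addrC.
rewrite -e1 chiM chiX mulrA (exprD _ (4 * k)) (exprM (-1) 4) s4 expr1n mul1r.
by rewrite sq mul1r.
Qed.

Let B_reflect e : (e <= 8 * m)%N -> B (8 * m - e) = (-1) ^+ e * B e.
Proof.
move=> eN; rewrite /B mulr_sumr -(sum_reverse (W_period _) (fun k _ => erefl _)).
by apply: eq_bigr => k _; apply: W_reflect => //; apply: ltnW.
Qed.

Let B_add8 e j : B (e + 8 * j) = B e.
Proof.
elim: j => [|j IHj]; first by rewrite addn0.
by rewrite mulnS addnCA addnC -[8%N]/(4 + 4)%N addnA !B_add4 opprK.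
Qed.

Let B2 : B 2 = 0.
Proof.
have := @B_reflect 2; rewrite expr2 mulrNN !mul1r.
rewrite (_ : 8 * m - 2 = 2 + 4 + 8 * m.-1)%N; last by lia.
rewrite B_add8 B_add4 => e; have : - B 2 = B 2 by apply: e; lia.
lia.
Qed.

Let B3 : B 3 ^+ 2 = B 1 ^+ 2.
Proof.
have := @B_reflect 1; rewrite expr1 mulN1r.
rewrite (_ : 8 * m - 1 = 3 + 4 + 8 * m.-1)%N; last by lia.
rewrite B_add8 B_add4 => /(_ _)/oppr_inj-> //; lia.
Qed.

(** Expanding the square, the sums over e are quadratic character sums. The
    off-diagonal constant -2 is multiplied by alternating signs, whose sum over
    a period vanishes. *)
Let B_moment : \sum_(e < 4 * (2 * m)) B e ^+ 2 = (2 * m)%N%:Z * p%:Z.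
Proof.
transitivity (\sum_(j < 2 * m) \sum_(k < 2 * m) \sum_(e < #|F|.-1) W e j * W e k).
  rewrite (_ : 4 * (2 * m) = #|F|.-1)%N; last by rewrite cardF; lia.
  under [RHS]eq_bigr => j _ do rewrite exchange_big.
  rewrite exchange_big; apply: eq_bigr => e _ /=.
  by rewrite expr2 /B mulr_suml; apply: eq_bigr => j _; rewrite mulr_sumr.
have inner (j k : 'I_(2 * m)) : \sum_(e < #|F|.-1) W e j * W e k =
    (-1) ^+ j * (-1) ^+ k * (p%:Z * (j == k)%:R - 2).
  transitivity ((-1) ^+ j * (-1) ^+ k *
     \sum_(e < #|F|.-1) chi ((g ^+ (4 * j) + g ^+ e) * (g ^+ (4 * k) + g ^+ e))).
    rewrite mulr_sumr; apply: eq_bigr => e _; rewrite /W !chiX chiM; ring.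
  congr (_ * _).
  rewrite (sum_primitive_powers gP (fun x => chi ((g ^+ (4 * j) + x) * (g ^+ (4 * k) + x)))).
  have := sum_chi_quadratic (g ^+ (4 * j)) (g ^+ (4 * k)); rewrite (bigD1 0) //= !addr0.
  rewrite chiM !chiX !exprM s4 !expr1n mul1r.
  rewrite -!exprM g_eq !modn_small; [|have := ltn_ord k; lia|have := ltn_ord j; lia].
  rewrite eqn_pmul2l // -[((j : nat) == k)%N]/(j == k).
  by move/(canRL (addKr _)) => ->; case: (j == k); rewrite /= ?mulr1 ?mulr0; ring.
transitivity (\sum_(j < 2 * m) (p%:Z - 2 * (-1) ^+ j * \sum_(k < 2 * m) (-1) ^+ k)).
  apply: eq_bigr => j _; under eq_bigr => k _ do rewrite inner mulrBr.
  rewrite sumrB; congr (_ - _).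
    rewrite (bigD1 j) //= big1 => [|k kj]; last by rewrite eq_sym (negPf kj) !mulr0.
    by rewrite eqxx -expr2 sqrr_sign mul1r mulr1 addr0.
  by rewrite mulr_sumr; apply: eq_bigr => k _; ring.
have -> : \sum_(k < 2 * m) (-1) ^+ k = 0 :> int.
  elim: (m) => [|q IHq]; first by rewrite big_ord0.
  by rewrite (_ : 2 * q.+1 = (2 * q).+2)%N ?mulnS // !big_ord_recr /= IHq exprS; ring.
under eq_bigr => j _ do rewrite mulr0 subr0.
by rewrite sumr_const card_ord -mulr_natl natz.
Qed.

Let B_two_squares : p%:Z = B 0 ^+ 2 + 2 * B 1 ^+ 2.
Proof. by apply: two_squares_of_period4 B_add4 B2 B3 B_moment; lia. Qed.

(** As g^(4m) = -1, twice the square g^(2m) equals (1 + g^(2m))^2. *)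
Let chi2 : chi 2%:R = 1.
Proof.
have sq : g ^+ (2 * m) * 2%:R = (1 + g ^+ (2 * m)) ^+ 2.
  by rewrite sqrrD expr1n mul1r -exprM (_ : 2 * m * 2 = 4 * m)%N ?ghalf; [ring|lia].
have := congr1 chi sq; rewrite expr2 !chiM chiX exprM sqrrN !expr1n mul1r => ->.
rewrite -expr2 (qchar_sqr pp chp ph) // (_ : 1 + _ != 0) //.
apply: contraTneq isT => e; move/eqP: sq; rewrite e expr0n /= mulf_eq0.
by rewrite (negPf (natr2_neq0 pp chp ph)) orbF expf_eq0 (negPf g0) andbF.
Qed.

(** The terms of index k and 2m - k agree; the term of index 0 is chi(2) = 1,
    the one of index m is 0, and the others are 1 or -1. *)
Let B_mod4 : (B 0 = 2 * m%:Z - 1 %[mod 4])%Z.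
Proof.
have W8 k : W (8 * m) k = W 0 k by rewrite /W gN expr0.
have sym k : (0 < k < 2 * m)%N -> W 0 (2 * m - k) = W 0 k.
  by case/andP=> _ /ltnW kw; rewrite -{1}W8 -{1}[(8 * m)%N]subn0 W_reflect // expr0 mul1r.
have := sum_symmetric_even m_gt0 sym; rewrite -/(B 0).
have -> : W 0 0 = 1 by rewrite /W muln0 !expr0 -[1 + 1]/(2%:R) chi2 qchar1.
have -> : W 0 m = 0 by rewrite /W ghalf expr0 addNr (qchar0 F pp ph) mulr0.
have [//|k /andP[k0 km]|t ->] := @sum_odd_mod4 (W 0) 1 m.
  rewrite /W exprMn chiX sqrr_sign mul1r (qchar_sqr pp chp ph) // addr_eq0 -ghalf g_eq.
  by rewrite !modn_small ?eqn_pmul2l ?(ltn_eqF km) //; lia.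
by move=> ->; lia.
Qed.

Lemma split_character_sum : exists A B k : int,
  [/\ p%:Z = A ^+ 2 + 2 * B ^+ 2, (A = 2 * m%:Z - 1 %[mod 4])%Z
    & 4 * A = (p%:Z - 1) * (3 * 'C(4 * m, m)%:Z - 'C(12 * m, m)%:Z - 'C(12 * m, 3 * m)%:Z
                 - 'C(12 * m, 5 * m)%:Z) + p%:Z ^+ 2 * k].
Proof.
have p21 : (1 < p ^ 2)%N by rewrite (ltn_exp2l 0) ?prime_gt1.
pose R : comNzRingType := 'Z_(p ^ 2).
have hR (z : int) : z%:~R = 0 :> R -> (p%:Z ^+ 2 %| z)%Z.
  by rewrite (_ : p%:Z ^+ 2 = (p ^ 2)%N%:Z) ?PoszM ?expr2 //; apply: intr_Zp_eq0.
have p2 : p%:R ^+ 2 = 0 :> R by rewrite -natrX; apply: pchar_Zp.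
have [G GF] : exists G : int, G%:~R = g by exists (g : nat); rewrite -[RHS]natr_Zp.
pose u : R := G%:~R ^+ p.
have uN : u ^+ (8 * m) = 1.
  have : (p%:Z %| G ^+ (8 * m) - 1)%Z.
    by rewrite (dvdz_pcharf chp) rmorphB rmorphXn /= GF gN subrr.
  case/dvdzP=> t /(canRL (subrK _)) e.
  rewrite /u exprAC -rmorphXn /= e rmorphD rmorphM /= addrC mulrC; exact: expr_1Dp.
have ureg j : ~~ (8 * m %| j)%N -> GRing.lreg (u ^+ j - 1).
  move=> nj; have : ~~ (p%:Z %| (G ^+ p) ^+ j - 1)%Z.
    rewrite (dvdz_pcharf chp) rmorphB !rmorphXn /= GF xp subr_eq0 -[1](expr0 g) g_eq mod0n.
    exact: nj.
  case/(inverse_mod_p2 pp p2) => z' e; apply: (@lreg_of_mul_unit _ _ 1 z'%:~R).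
  by rewrite mul1r -[RHS]e rmorphB !rmorphXn.
pose y k : int := (G ^+ p) ^+ (2 * k) + (G ^+ p) ^+ ((8 * m).-1 * (2 * k)).
have yR k : (y k)%:~R = u ^+ (2 * k) + u ^+ ((8 * m).-1 * (2 * k)).
  by rewrite /y rmorphD !rmorphXn.
have Wy k : W 0 k = (-1) ^+ k * chi (y k)%:~R.
  rewrite /W chiX expr0; congr (_ * _).
  have e : g ^+ (2 * k) * (y k)%:~R = g ^+ (4 * k) + 1.
    rewrite /y rmorphD !rmorphXn /= GF xp mulrDr -!exprD.
    rewrite (_ : 2 * k + 2 * k = 4 * k)%N; last by lia.
    rewrite (_ : 2 * k + (8 * m).-1 * (2 * k) = 8 * m * (2 * k))%N; last by lia.
    by rewrite (exprM g (8 * m)) gN expr1n.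
  by rewrite -e chiM chiX exprM sqrrN !expr1n mul1r.
have c1 i : (i <= h)%N -> (8 * m %| 2 * (2 * m) + 2 * (8 * m).-1 * (h - i) + 2 * i)%N
    = (i %% (2 * m) == m)%N.
  by have := @split_residue m 1%N i m_gt0; rewrite mul1n.
have c3 := fun i => @split_residue m 3%N i m_gt0.
have h1 : (1 < h)%N by rewrite /h; lia.
have mw : (m < 2 * m)%N by lia.
have hw : (3 * h < 7 * (2 * m))%N by rewrite /h; lia.
have nw : (8 * m = 4 * (2 * m))%N by lia.
have [K] := @character_sum_mod_p2 F R p h u (8 * m) (2 * m) y m m pp chp ph h1 hR nw mw mw hw
  uN ureg yR c1 c3.
have -> : \sum_(k < 8 * m) (-1) ^+ k * chi ((y k)%:~R : F) = 4 * B 0.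
  under eq_bigr => k _ do rewrite -Wy.
  by rewrite nw (sum_periodic_mul 4 (W_period 0)).
have [b1 b3] := split_binomials m_gt0; rewrite b1 b3.
have -> : (8 * m)%N%:Z = p%:Z - 1 by rewrite pm intS addrC addKr.
move=> eK; exists (B 0), (B 1).
have p_odd : odd p by rewrite pm /= oddM.
have [|K' eK'] := halve_mod_p2 (a := 4 * B 0) (b := (p%:Z - 1) * (3 * 'C(4 * m, m)%:Z
  - 'C(12 * m, m)%:Z - 'C(12 * m, 3 * m)%:Z - 'C(12 * m, 5 * m)%:Z)) (K := K) p_odd.
  by rewrite eK !PoszM !PoszD; ring.
by exists K'; split; [exact: B_two_squares|exact: B_mod4|].
Qed.
End Split.

Lemma character_sum_split p m : prime p -> p = (8 * m).+1 ->
  exists A B k : int,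
  [/\ p%:Z = A ^+ 2 + 2 * B ^+ 2, (A = 2 * m%:Z - 1 %[mod 4])%Z
    & 4 * A = (p%:Z - 1) * (3 * 'C(4 * m, m)%:Z - 'C(12 * m, m)%:Z - 'C(12 * m, 3 * m)%:Z
                 - 'C(12 * m, 5 * m)%:Z) + p%:Z ^+ 2 * k].
Proof.
move=> pp pm; have [g gP] := finField_primitive_root 'F_p.
exact: split_character_sum pp pm g gP.
Qed.

(** * Gaussian numbers over a ring *)
(** The ring R[i]. For R = Z/p^2 it plays the role of the Galois ring with
    residue field of order p^2, in which -1 is not a square modulo p. *)
Definition gauss (R : comNzRingType) : Type := (R * R)%type.

Section Gauss.
Variable R : comNzRingType.
Local Notation G := (gauss R).
HB.instance Definition _ := GRing.Zmodule.on G.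

Definition gauss_mul (x y : G) : G := (x.1 * y.1 - x.2 * y.2, x.1 * y.2 + x.2 * y.1).
Definition gauss_one : G := (1, 0).

Fact gauss_mulA : associative gauss_mul.
Proof. by move=> x y z; congr pair => /=; ring. Qed.
Fact gauss_mulC : commutative gauss_mul.
Proof. by move=> x y; congr pair => /=; ring. Qed.
Fact gauss_mul1 : left_id gauss_one gauss_mul.
Proof. by case=> x y; congr pair => /=; ring. Qed.
Fact gauss_mulD : left_distributive gauss_mul +%R.
Proof. by move=> x y z; congr pair => /=; ring. Qed.
Fact gauss_1neq0 : gauss_one != 0.
Proof. by apply/eqP => -[/eqP]; rewrite oner_eq0. Qed.

HB.instance Definition _ := GRing.Zmodule_isComNzRing.Build G
  gauss_mulA gauss_mulC gauss_mul1 gauss_mulD gauss_1neq0.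

Definition gauss_i : G := (0, 1).

Lemma gauss_i_sqr : gauss_i ^+ 2 = -1.
Proof. by rewrite expr2; congr pair => /=; ring. Qed.

Lemma gauss_natr n : n%:R = (n%:R, 0) :> G.
Proof. by elim: n => // n IHn; rewrite -!natr1 IHn; congr pair => /=; rewrite addr0. Qed.

Lemma gauss_intr (z : int) : z%:~R = (z%:~R, 0) :> G.
Proof.
case: z => n; first exact: gauss_natr.
by rewrite NegzE !mulrNz -!pmulrn gauss_natr; congr pair => /=; rewrite oppr0.
Qed.
End Gauss.

Section Eval.
Variables (S : comNzRingType) (j : S).
Hypothesis j2 : j ^+ 2 = -1.
(** The ring morphism sending i to a square root [j] of -1. It reduces Gaussian
    integers both to the field of order p^2 and to (Z/p^2)[i], so that elements
    of the two rings can be compared. *)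
Definition gauss_eval (x : gauss int) : S := x.1%:~R + x.2%:~R * j.

Lemma gauss_evalM x y : gauss_eval (x * y) = gauss_eval x * gauss_eval y.
Proof.
rewrite /gauss_eval /= !(intrD, intrM, mulrNz).
transitivity (x.1%:~R * y.1%:~R + x.2%:~R * y.2%:~R * j ^+ 2
  + (x.1%:~R * y.2%:~R + x.2%:~R * y.1%:~R) * j).
  by rewrite j2; ring.
ring.
Qed.

Lemma gauss_eval1 : gauss_eval 1 = 1.
Proof. by rewrite /gauss_eval /= mul0r addr0. Qed.

Lemma gauss_evalX x n : gauss_eval (x ^+ n) = gauss_eval x ^+ n.
Proof. by elim: n => [|n IHn]; rewrite ?gauss_eval1 // !exprS gauss_evalM IHn. Qed.

Lemma gauss_evalB1 x : gauss_eval (x - 1) = gauss_eval x - 1.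
Proof. by rewrite /gauss_eval /= intrD subr0 mulrNz; ring. Qed.

End Eval.

Lemma gauss_eval_conjD (S : comNzRingType) (j : S) x :
  gauss_eval j x + gauss_eval (- j) x = (2 * x.1)%:~R.
Proof. by rewrite /gauss_eval intrM; ring. Qed.

Lemma gauss_eval_conjM (S : comNzRingType) (j : S) x : j ^+ 2 = -1 ->
  gauss_eval j x * gauss_eval (- j) x = (x.1 ^+ 2 + x.2 ^+ 2)%:~R.
Proof.
move=> j2; rewrite /gauss_eval intrD !rmorphXn /=.
transitivity (x.1%:~R ^+ 2 - x.2%:~R ^+ 2 * j ^+ 2); first by ring.
by rewrite j2; ring.
Qed.

(** The polynomial X^p - X has at most p roots, and the images of 0, ..., p-1
    are p of them. *)
Lemma prime_subfield_int (F : fieldType) p (x : F) : prime p -> p \in [pchar F] -> x ^+ p = x ->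
  exists z : int, x = z%:~R.
Proof.
move=> pp chp xp; pose P : {poly F} := 'X^p - 'X; pose s := [seq (i%:R : F) | i <- iota 0 p].
have p1 := prime_gt1 pp.
have szP : size P = p.+1 by rewrite size_polyDl ?size_polyXn // size_polyN size_polyX ltnS.
have [/mapP[i _ ->]|xs] := boolP (x \in s); first by exists i%:Z.
have P0 : P != 0 by rewrite -size_poly_gt0 szP.
have rootP y : y ^+ p = y -> root P y.
  by move=> yp; rewrite /root !hornerE yp subrr.
have := @max_poly_roots _ P (x :: s) P0; rewrite szP /= size_map size_iota ltnn.
have inj : {in iota 0 p &, injective (fun i : nat => i%:R : F)}.
  have le i k : (i <= k < p)%N -> i%:R = k%:R :> F -> i = k.
    move=> /andP[ik kp] e; have : (p %| k - i)%N.
      by rewrite (dvdn_pcharf chp) natrB // e subrr.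
    by have [/eqP|/dvdn_leq le_p /le_p] := posnP (k - i); lia.
  move=> i k; rewrite !mem_iota !add0n => /= ip kp e.
  by have [ik|/ltnW ki] := leqP i k; [apply: le|apply/esym/le]; rewrite ?ik ?ki.
rewrite xs (map_inj_in_uniq inj) iota_uniq rootP //= => h.
have : false; last by [].
apply: h => //; apply/allP => _ /mapP[i _ ->]; apply: rootP.
by rewrite -(pFrobenius_autE chp) rmorph_nat.
Qed.

(** * Character sums for p = 3 modulo 8 *)
Section Inert.
Variables (p m : nat) (pp : prime p) (pm : p = (8 * m + 3)%N) (m_gt0 : (0 < m)%N).
Variables (F : finFieldType) (chp : p \in [pchar F]) (cardF : #|F| = (p ^ 2)%N) (g : F).
Hypothesis gP : #|F|.-1.-primitive_root g.
Let h := (4 * m + 1)%N.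
Let w := (2 * m).+1.
Notation chi := (@qchar F h).
Let q := p.-1.

Let ph : p = (2 * h).+1. Proof. by rewrite /h; lia. Qed.
Let pq : p = q.+1. Proof. by rewrite /q prednK ?prime_gt0. Qed.
Let pw : p.+1 = (4 * w)%N. Proof. by rewrite /w; lia. Qed.
Let qw : q = (2 * (2 * w).-1)%N. Proof. by rewrite /q /w; lia. Qed.
Let q_gt0 : (0 < q)%N. Proof. by rewrite /q; lia. Qed.
Let cardN : #|F|.-1 = (q * (4 * w))%N.
Proof. by rewrite cardF -pw /q; move: (prime_gt0 pp); case: (p) => // n _; rewrite -mulnn; lia. Qed.
Let gN : g ^+ (q * (4 * w)) = 1. Proof. by rewrite -cardN (prim_expr_order gP). Qed.
Let g0 := primitive_root_neq0 gP.
Let g_eq i j : (g ^+ i == g ^+ j) = (i == j %[mod q * (4 * w)])%N.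
Proof. by rewrite (eq_prim_root_expr gP) cardN. Qed.
Let ghalf : g ^+ (q * (2 * w)) = -1.
Proof.
have : (g ^+ (q * (2 * w))) ^+ 2 == 1.
  by rewrite -exprM (_ : q * (2 * w) * 2 = q * (4 * w))%N ?gN //; lia.
rewrite sqrf_eq1 => /orP[|/eqP//].
rewrite -[1](expr0 g) g_eq mod0n modn_small ?muln_eq0 ?ltn_pmul2l //=; last by rewrite /w; lia.
by rewrite (gtn_eqF q_gt0) /w.
Qed.

Let m3 : (2 * m.-1 + 3 = 2 * m + 1)%N. Proof. lia. Qed.
Let h1 : (1 < h)%N. Proof. rewrite /h; lia. Qed.
Let mw : (m < w)%N. Proof. rewrite /w; lia. Qed.
Let hw : (3 * h < 7 * w)%N. Proof. rewrite /h /w; lia. Qed.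

Let frD (x y : F) : (x + y) ^+ p = x ^+ p + y ^+ p.
Proof. by rewrite -!(pFrobenius_autE chp) rmorphD. Qed.
Let frN (x : F) : (- x) ^+ p = - x ^+ p.
Proof. by rewrite -!(pFrobenius_autE chp) rmorphN. Qed.
Let frK (x : F) : (x ^+ p) ^+ p = x.
Proof. by rewrite -exprM mulnn -cardF expf_card. Qed.
(** The trace to the prime field, as an element of [F]. *)
Definition tr (x : F) : F := x + x ^+ p.
Let trK x : tr x ^+ p = tr x. Proof. by rewrite frD frK addrC. Qed.
Let trD x y : tr (x + y) = tr x + tr y. Proof. by rewrite /tr frD; ring. Qed.
Let trN x : tr (- x) = - tr x. Proof. by rewrite /tr frN opprD. Qed.
Let trZ c x : c ^+ p = c -> tr (c * x) = c * tr x.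
Proof. by move=> cp; rewrite /tr exprMn cp mulrDr. Qed.
Let tr_frob x : tr (x ^+ p) = tr x. Proof. by rewrite /tr frK addrC. Qed.

Let chiM x y : x ^+ p = x -> chi (x * y) = chi x * chi y. Proof. exact: qcharM. Qed.
Let chiN x : chi (- x) = - chi x.
Proof.
rewrite -mulN1r chiM; last by rewrite frN expr1n.
rewrite (_ : chi (-1) = -1) ?mulN1r // /qchar -signr_odd.
by rewrite /h oddD oddM /= expr1 eq_sym (oppr1_neq1 pp chp ph) eqxx.
Qed.
Let chi0 : chi 0 = 0. Proof. exact: (qchar0 F pp ph). Qed.

(** With theta = g^(p-1), a generator of the group of elements of norm 1, this
    is (-1)^k chi(Tr(g^e theta^(2k))). *)
Let W e k : int := (-1) ^+ k * chi (tr (g ^+ (e + q * (2 * k)))).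
Let B e : int := \sum_(k < w) W e k.

Let W_period e k : W e (k + w) = W e k.
Proof.
rewrite /W (_ : e + q * (2 * (k + w)) = e + q * (2 * k) + q * (2 * w))%N; last by lia.
rewrite (exprD g) ghalf mulrN1 trN chiN exprD -[(-1) ^+ w]signr_odd /w /= oddM /= expr1; ring.
Qed.

(** Indeed g^4 theta^2 = (g^(p+1))^2 is the square of an element of the prime
    field. *)
Let W_add4 e k : W (e + 4) k.+1 = - W e k.
Proof.
have c : (g ^+ p.+1) ^+ p = g ^+ p.+1.
  rewrite -exprM; apply/eqP; rewrite g_eq.
  rewrite (_ : p.+1 * p = q * (4 * w) + p.+1)%N ?modnDl //.
  by rewrite -pw /q; move: (prime_gt0 pp); case: (p) => // n _ /=; lia.
rewrite /W (_ : e + 4 + q * (2 * k.+1) = p.+1 + (p.+1 + (e + q * (2 * k))))%N; last first.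
  by rewrite /q; move: (prime_gt0 pp); case: (p) => // n _ /=; lia.
rewrite !(exprD g p.+1) !trZ // !chiM // mulrA -expr2 (qchar_sqr pp chp ph) // expf_neq0 //.
by rewrite exprS mul1r; ring.
Qed.

Let B_add4 e : B (e + 4) = - B e.
Proof.
rewrite /B -(sum_periodic_shift (W_period (e + 4))) -sumrN; apply: eq_bigr => k _.
exact: W_add4.
Qed.

Let W_frob e k : W (p * e) (p * k) = W e k.
Proof.
rewrite /W (_ : p * e + q * (2 * (p * k)) = (e + q * (2 * k)) * p)%N; last by lia.
rewrite (exprM g _ p) tr_frob; congr (_ * _).
by rewrite exprM -[(-1) ^+ p]signr_odd ph /= oddM /= expr1.
Qed.

(** Modulo the period w, multiplying k by p is the same as changing its sign. *)
Let W_reflect e k : (k <= w)%N -> W (p * e) (w - k) = W e k.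
Proof.
have per n j : W (p * e) (j + n * w) = W (p * e) j.
  by elim: n => [|n IHn]; rewrite ?addn0 // mulSn addnCA addnC W_period.
move=> kw; rewrite -[RHS]W_frob; have [->|k0] := posnP k.
  by rewrite subn0 muln0 -[w]add0n W_period.
by rewrite -(per (4 * k).-1) -(_ : p * k = w - k + (4 * k).-1 * w)%N //; move: pw; nia.
Qed.

Let B_frob e : B (p * e) = B e.
Proof.
rewrite /B -(sum_reverse (W_period _) (fun k _ => erefl _)).
by apply: eq_bigr => k _; apply: W_reflect; apply: ltnW.
Qed.

Let B_add8 e j : B (e + 8 * j) = B e.
Proof.
elim: j => [|j IHj]; first by rewrite addn0.
by rewrite mulnS addnCA addnC -[8%N]/(4 + 4)%N addnA !B_add4 opprK.
Qed.

Let B2 : B 2 = 0.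
Proof.
have := B_frob 2; rewrite (_ : p * 2 = 2 + 4 + 8 * (2 * m))%N; last by lia.
by rewrite B_add8 B_add4; lia.
Qed.

Let B3 : B 3 ^+ 2 = B 1 ^+ 2.
Proof.
have := B_frob 1; rewrite (_ : p * 1 = 3 + 8 * m)%N; last by lia.
by rewrite B_add8 => ->.
Qed.

(** The trace of x vanishes when x^(p-1) = -1 = g^((p-1) 2w). *)
Let tr_eq0 e : (tr (g ^+ e) == 0) = (e %% (4 * w) == 2 * w)%N.
Proof.
have e0 : g ^+ e != 0 by rewrite expf_neq0.
have -> : tr (g ^+ e) = g ^+ e * (g ^+ (q * e) + 1).
  by rewrite /tr mulrDr mulr1 addrC -exprM -exprD; rewrite {1}pq mulnS (mulnC q).
rewrite mulf_eq0 (negPf e0) addr_eq0 -ghalf g_eq -!muln_modr eqn_pmul2l //.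
by rewrite [in RHS](_ : (2 * w = (2 * w) %% (4 * w))%N) // modn_small // /w; lia.
Qed.

Let sum_chi_tr_sqr : \sum_(x : F) chi (tr x) ^+ 2 = (q * p)%N%:Z.
Proof.
rewrite (bigD1 0) //= /tr expr0n (gtn_eqF (prime_gt0 pp)) addr0 chi0 expr0n add0r -/tr.
rewrite -(sum_primitive_powers gP (fun x => chi (tr x) ^+ 2)) cardN.
have -> : \sum_(e < q * (4 * w)) chi (tr (g ^+ e)) ^+ 2 =
    \sum_(e < q * (4 * w)) (1 - (e %% (4 * w) == 2 * w)%N%:R).
  apply: eq_bigr => e _; rewrite (qchar_sqr pp chp ph) // tr_eq0.
  by case: (_ == _)%N.
rewrite sumrB sumr_const card_ord -natr_sum.
have -> : (\sum_(e < q * (4 * w)) (e %% (4 * w) == 2 * w))%N = q.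
  rewrite -(big_mkord xpredT (fun e => nat_of_bool (e %% (4 * w) == 2 * w)%N)).
  have := @big_nat_residue q (4 * w) (2 * w) (fun=> 1%N); rewrite sum_nat_const_nat subn0 muln1.
  move=> e; rewrite -[RHS]e; last by rewrite /w; lia.
  by rewrite [RHS]big_mkcond {e}; apply: eq_bigr => e _; case: (_ == _)%N.
by rewrite !natz -pw mulnS PoszD addrC addKr.
Qed.

(** The linear forms tr(x a) and tr(x b) are independent, so there is a
    reflection phi that fixes the first and negates the second. As chi(-1) = -1,
    the sum equals its opposite. *)
Let sum_chi_tr_orthogonal (a b : F) : a != 0 -> b != 0 -> a ^+ q != b ^+ q ->
  \sum_(x : F) chi (tr (x * a)) * chi (tr (x * b)) = 0.
Proof.
move=> a0 b0 ab.
pose i := g ^+ (2 * w).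
(* An element of trace 0 supplies the direction of the reflection. *)
have ip : i ^+ p = - i.
  rewrite /i -exprM (_ : 2 * w * p = q * (2 * w) + 2 * w)%N ?(exprD g) ?ghalf ?mulN1r //.
  by rewrite /q; move: (prime_gt0 pp); case: (p) => // n _ /=; lia.
have i0 : i != 0 by rewrite expf_neq0.
pose c := i / a; pose D := tr (c * b).
have ca : tr (c * a) = 0 by rewrite /c divfK // /tr ip subrr.
have D0 : D != 0.
  rewrite /D /tr /c !exprMn ip exprVn pq !exprS.
  have -> : i / a * b + - i * (a * a ^+ q)^-1 * (b * b ^+ q)
      = i * b / a * ((a ^+ q - b ^+ q) / a ^+ q).
    by field; rewrite a0 expf_neq0.
  by rewrite !mulf_neq0 ?invr_neq0 ?expf_neq0 // subr_eq0.
pose phi x := x - (2%:R * tr (x * b) / D) * c.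
have tK x : (2%:R * tr (x * b) / D) ^+ p = 2%:R * tr (x * b) / D.
  by rewrite !exprMn exprVn !trK -[2%:R]/(2%:~R) (intr_exp_p chp).
have phia x : tr (phi x * a) = tr (x * a).
  by rewrite /phi mulrBl trD trN -[_ * c * a]mulrA trZ // ca mulr0 subr0.
have phib x : tr (phi x * b) = - tr (x * b).
  rewrite /phi mulrBl trD trN -[_ * c * b]mulrA trZ // -/D divfK //; ring.
have phiK : involutive phi.
  move=> x; rewrite {1}/phi phib /phi; ring.
have : \sum_(x : F) chi (tr (x * a)) * chi (tr (x * b)) =
     - \sum_(x : F) chi (tr (x * a)) * chi (tr (x * b)).
  rewrite {1}(reindex_inj (inv_inj phiK)) /= -sumrN; apply: eq_bigr => x _.
  by rewrite phia phib chiN mulrN.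
lia.
Qed.

Let B_moment : \sum_(e < 4 * (q * w)) B e ^+ 2 = (q * w)%N%:Z * p%:Z.
Proof.
transitivity (\sum_(j < w) \sum_(k < w) \sum_(e < #|F|.-1) W e j * W e k).
  rewrite (_ : 4 * (q * w) = #|F|.-1)%N; last by rewrite cardN; lia.
  under [RHS]eq_bigr => j _ do rewrite exchange_big.
  rewrite exchange_big; apply: eq_bigr => e _ /=.
  by rewrite expr2 /B mulr_suml; apply: eq_bigr => j _; rewrite mulr_sumr.
have inner (j k : 'I_w) : \sum_(e < #|F|.-1) W e j * W e k = if j == k then (q * p)%N%:Z else 0.
  pose a := g ^+ (q * (2 * j)); pose b := g ^+ (q * (2 * k)).
  transitivity ((-1) ^+ j * (-1) ^+ k * \sum_(x : F) chi (tr (x * a)) * chi (tr (x * b))).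
    rewrite (bigD1 (0 : F)) //= !mul0r /tr expr0n (gtn_eqF (prime_gt0 pp)) addr0.
    rewrite chi0 mul0r add0r -/tr.
    rewrite -(sum_primitive_powers gP (fun x => chi (tr (x * a)) * chi (tr (x * b)))) mulr_sumr.
    by apply: eq_bigr => e _; rewrite /W !(exprD g); ring.
  have [jk|jk] := eqVneq j k.
    have a0 : a != 0 by rewrite expf_neq0.
    have -> : b = a by rewrite /b -jk.
    rewrite -jk -expr2 sqrr_sign mul1r -sum_chi_tr_sqr.
    by rewrite [RHS](reindex_inj (mulIf a0)); apply: eq_bigr => x _; rewrite [RHS]expr2.
  rewrite sum_chi_tr_orthogonal ?mulr0 ?expf_neq0 //.
  have red l : (q * (2 * l) * q = q * (4 * ((2 * w).-1 * l)))%N.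
    by rewrite -mulnA; congr (_ * _)%N; rewrite {1}qw; lia.
  rewrite /a /b -!exprM !red g_eq -!muln_modr !eqn_pmul2l //.
  apply: contra jk; rewrite -(eqn_modDr (j + k)).
  have shift l n : ((2 * w).-1 * l + (l + n) = 2 * l * w + n)%N.
    by rewrite addnA mul_pred //; lia.
  rewrite shift (addnC j k) shift !modnMDl !modn_small // => /eqP e.
  exact/eqP/val_inj.
under eq_bigr => j _ do under eq_bigr => k _ do rewrite inner.
transitivity (\sum_(j < w) (q * p)%N%:Z).
  by apply: eq_bigr => j _; rewrite -big_mkcond (big_pred1 j).
rewrite sumr_const card_ord -mulr_natl natz -!PoszM; congr Posz; lia.
Qed.

Let B_two_squares : p%:Z = B 0 ^+ 2 + 2 * B 1 ^+ 2.
Proof.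
apply: two_squares_of_period4 B_add4 B2 B3 B_moment.
by rewrite muln_gt0 q_gt0.
Qed.

(** For a primitive 8th root of unity z, the element z + z^3 = z + z^p lies in
    the prime field and its square is -2. *)
Let chi2 : chi 2%:R = -1.
Proof.
pose z := g ^+ ((4 * m + 1) * w).
have z4 : z ^+ 4 = -1.
  by rewrite /z -exprM -ghalf; congr (_ ^+ _); rewrite /q; lia.
have z8 : z ^+ 8 = 1 by rewrite (exprM z 4 2) z4 sqrrN expr1n.
have zp : z ^+ p = z ^+ 3 by rewrite pm exprD exprM z8 expr1n mul1r.
have z3p : (z ^+ 3) ^+ p = z by rewrite exprAC zp -exprM (exprD z 8 1) z8 mul1r.
have sp : (z + z ^+ 3) ^+ p = z + z ^+ 3 by rewrite frD zp z3p addrC.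
have s2 : (z + z ^+ 3) ^+ 2 = - 2%:R.
  transitivity (z ^+ 2 * (1 + z ^+ 4) + 2%:R * z ^+ 4); first by ring.
  by rewrite z4; ring.
have s0 : z + z ^+ 3 != 0.
  apply/eqP => s0; move/eqP: s2; rewrite s0 expr0n /= eq_sym oppr_eq0.
  exact/negP/(natr2_neq0 pp chp ph).
have := congr1 chi s2; rewrite chiN expr2 chiM // -expr2 (qchar_sqr pp chp ph) // s0 => e.
by rewrite -[LHS]opprK -e.
Qed.

(** The term of index 0 is chi(2) = -1. The others are 1 or -1 and agree in
    pairs k, w - k; none vanishes, because w is odd. *)
Let B_mod4 : (B 0 = 2 * m%:Z - 1 %[mod 4])%Z.
Proof.
have sym k : (0 < k <= 2 * m)%N -> W 0 ((2 * m).+1 - k) = W 0 k.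
  by case/andP=> _ kw; rewrite -{1}(muln0 p) W_reflect // ltnW.
have := sum_symmetric_odd sym; rewrite -/(B 0).
have -> : W 0 0 = -1.
  by rewrite /W !muln0 !expr0 mul1r /tr expr1n -[1 + 1]/(2%:R) chi2.
have [//|k /andP[k0 km]|t ->] := @sum_odd_mod4 (W 0) 1 m.+1.
  rewrite /W exprMn sqrr_sign mul1r (qchar_sqr pp chp ph) // tr_eq0 add0n.
  case: eqP => // e; have := divn_eq (q * (2 * k)) (4 * w); rewrite e.
  have := @mul_pred (2 * w) (2 * k) isT.
  have qk : (q * (2 * k) = 2 * ((2 * w).-1 * (2 * k)))%N by rewrite {1}qw -mulnA.
  move: (_ %/ _)%N => s; rewrite qk -(mulnA 2%N w) (mulnCA w) (mulnCA s 4%N).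
  move: (_ * (2 * k))%N (s * w)%N (w * k)%N => P Y X {e qk}; rewrite /w; lia.
by move=> ->; rewrite subn1 /=; lia.
Qed.

(** The generator theta is written a + b i with integers a and b. In [R] the
    conjugates U = a + b j and V = a - b j satisfy U^(p+1) = UV = 1 up to a
    multiple of p, and these errors disappear on taking p-th powers. *)
Lemma inert_character_sum (R : comNzRingType) (j : R) :
    j ^+ 2 = -1 -> p%:R ^+ 2 = 0 :> R ->
    (forall z : int, z%:~R = 0 :> R -> (p%:Z ^+ 2 %| z)%Z) ->
  exists A B k : int,
  [/\ p%:Z = A ^+ 2 + 2 * B ^+ 2, (A = 2 * m%:Z - 1 %[mod 4])%Z
    & 4 * A = (p%:Z + 1) * (3 * 'C(4 * m + 1, m)%:Z - 'C(12 * m + 3, 11 * m + 4)%:Z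
                 - 'C(12 * m + 3, 3 * m)%:Z
                 - 'C(12 * m + 3, 5 * m + 1)%:Z) + p%:Z ^+ 2 * k].
Proof.
move=> j2 p2 hR.
have two0 := natr2_neq0 pp chp ph.
have twop : (2%:R : F) ^+ p = 2%:R by rewrite -[2%:R]/(2%:~R) (intr_exp_p chp).
pose th := g ^+ q; pose i := g ^+ (q * w).
have i2 : i ^+ 2 = -1 by rewrite /i -exprM -ghalf; congr (_ ^+ _); lia.
have Ni2 : (- i) ^+ 2 = -1 by rewrite sqrrN.
have ip : i ^+ p = - i.
  by rewrite ph exprS exprM i2 -signr_odd /h oddD oddM /= expr1 mulrN1.
have i0 : i != 0 by rewrite expf_neq0.
have thN : th ^+ p.+1 = 1 by rewrite /th -exprM pw gN.
have thpp : th ^+ (p * p) = th by rewrite exprM frK.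
have [a aE] : exists a : int, (th + th ^+ p) / 2%:R = a%:~R.
  by apply: (prime_subfield_int pp chp); rewrite exprMn exprVn twop frD frK addrC.
have [b bE] : exists b : int, (th - th ^+ p) / (2%:R * i) = b%:~R.
  apply: (prime_subfield_int pp chp); rewrite exprMn exprVn exprMn twop ip frD frN frK.
  by field; rewrite oppr_eq0 two0 i0.
pose ga : gauss int := (a, b).
have ev1 : gauss_eval i ga = th.
  by rewrite /gauss_eval /= -aE -bE; field; rewrite two0 i0.
have ev2 : gauss_eval (- i) ga = th ^+ p.
  by rewrite /gauss_eval /= -aE -bE; field; rewrite two0 i0.
have Nj2 : (- j) ^+ 2 = -1 by rewrite sqrrN.
pose U := gauss_eval j ga; pose V := gauss_eval (- j) ga.
have dvd (z : int) : z%:~R = 0 :> F -> exists t, z = p%:Z * t.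
  by move/eqP; rewrite -(dvdz_pcharf chp) => /dvdzP[t ->]; exists t; rewrite mulrC.
have uN : (U ^+ p) ^+ p.+1 = 1.
  pose c := ga ^+ p.+1.
  (* Both conjugates of c are 1 in F, so c = 1 modulo p as a Gaussian integer. *)
  have c1 : gauss_eval i c = 1 by rewrite gauss_evalX ?ev1.
  have c2 : gauss_eval (- i) c = 1 by rewrite gauss_evalX ?ev2 // exprAC thN expr1n.
  have [|s es] := dvd (c.1 - 1).
    have := gauss_eval_conjD i c; rewrite c1 c2 -[1 + 1]/(2%:R) intrM => e.
    by apply: (mulfI two0); rewrite intrD mulrBr -e mulr0 mulr1 subrr.
  have [|t et] := dvd c.2.
    move: c1; rewrite /gauss_eval (_ : c.1 = 1 + p%:Z * s); last by rewrite -es addrC subrK.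
    rewrite intrD intrM -pmulrn (pcharf0 chp) mul0r addr0 => /(canRL (addKr _)).
    by rewrite addNr => /eqP; rewrite mulf_eq0 (negPf i0) orbF => /eqP.
  rewrite exprAC -gauss_evalX // -/c /gauss_eval et (_ : c.1 = 1 + p%:Z * s); last first.
    by rewrite -es addrC subrK.
  rewrite intrD !intrM -pmulrn -addrA -mulrA -mulrDr; exact: expr_1Dp.
have UV : (U * V) ^+ p = 1.
  rewrite gauss_eval_conjM //; have [|t et] := dvd (ga.1 ^+ 2 + ga.2 ^+ 2 - 1).
    by rewrite intrB -(gauss_eval_conjM ga i2) ev1 ev2 -exprS thN subrr.
  rewrite (_ : ga.1 ^+ 2 + _ = 1 + p%:Z * t); last by rewrite -et [RHS]addrC subrK.
  by rewrite intrD intrM -pmulrn; apply: expr_1Dp.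
have VE : V ^+ p = (U ^+ p) ^+ p.
  by rewrite -[LHS]mulr1 -uN exprS mulrA [V ^+ p * _]mulrC -exprMn UV mul1r.
have ureg n : ~~ (p.+1 %| n)%N -> GRing.lreg ((U ^+ p) ^+ n - 1).
  (* The norm of x is an integer prime to p. *)
  move=> nn; pose x := ga ^+ (p * n) - 1.
  have thn : th ^+ n != 1.
    rewrite /th -exprM -[1](expr0 g) g_eq mod0n -pw; apply: contra nn.
    by rewrite -[_ == _]/(q * p.+1 %| q * n)%N dvdn_pmul2l.
  have xF : (x.1 ^+ 2 + x.2 ^+ 2)%:~R = (th ^+ (p * n) - 1) * (th ^+ n - 1) :> F.
    rewrite -(gauss_eval_conjM _ i2) !gauss_evalB1 !gauss_evalX // ev1 ev2.
    by rewrite -(exprM th p) mulnA (exprM th (p * p)) thpp.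
  have : ~~ (p%:Z %| x.1 ^+ 2 + x.2 ^+ 2)%Z.
    rewrite (dvdz_pcharf chp) xF mulf_neq0 // subr_eq0 //.
    apply: contra thn => /eqP e; apply/eqP.
    by rewrite -[LHS]frK -(exprM th n) (mulnC n) e expr1n.
  case/(inverse_mod_p2 pp p2) => z' e; apply: (@lreg_of_mul_unit _ _ (gauss_eval (- j) x) z'%:~R).
  rewrite -[RHS]e; congr (_ * _); rewrite -(gauss_eval_conjM _ j2) mulrC; congr (_ * _).
  by rewrite gauss_evalB1 gauss_evalX // exprM.
pose y k : int := 2 * (ga ^+ (p * (2 * k))).1.
have yR k : (y k)%:~R = (U ^+ p) ^+ (2 * k) + (U ^+ p) ^+ (p.+1.-1 * (2 * k)).
  have yU : gauss_eval j (ga ^+ (p * (2 * k))) = (U ^+ p) ^+ (2 * k).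
    by rewrite gauss_evalX // [LHS]exprM.
  have yV : gauss_eval (- j) (ga ^+ (p * (2 * k))) = (U ^+ p) ^+ (p * (2 * k)).
    by rewrite gauss_evalX // [LHS]exprM [RHS]exprM -VE.
  by rewrite -(gauss_eval_conjD j) yU yV.
have Wy k : W 0 k = (-1) ^+ k * chi (y k)%:~R.
  rewrite /W add0n; congr (_ * chi _).
  rewrite -(gauss_eval_conjD i) !gauss_evalX // ev1 ev2 -(exprM th p) (mulnA p p).
  rewrite (exprM th (p * p)) thpp [RHS]addrC /tr (exprM g q) -/th -(exprM th _ p).
  by rewrite [(2 * k * p)%N]mulnC.
have c1 l : (l <= h)%N -> (p.+1 %| 2 * w + 2 * p.+1.-1 * (h - l) + 2 * l)%N
    = (l %% w == m)%N.
  by have := @inert_residue m p 1 m l pm (leqnn m) (erefl _); rewrite mul1n.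
have c3 l : (l <= 3 * h)%N -> (p.+1 %| 2 * w + 2 * p.+1.-1 * (3 * h - l) + 2 * l)%N
    = (l %% w == m.-1)%N.
  exact: (@inert_residue m p 3 m.-1 l pm (leq_pred m) m3).
have mw' : (m.-1 < w)%N by apply: leq_ltn_trans mw; apply: leq_pred.
have [K] := @character_sum_mod_p2 F R p h (U ^+ p) p.+1 w y m m.-1 pp chp ph h1 hR pw mw mw' hw
  uN ureg yR c1 c3.
have -> : \sum_(k < p.+1) (-1) ^+ k * chi ((y k)%:~R : F) = 4 * B 0.
  under eq_bigr => k _ do rewrite -Wy.
  by rewrite pw (sum_periodic_mul 4 (W_period 0)).
have [b1 b3] := inert_binomials m_gt0; rewrite /w -[(2 * m).+1]addn1 b1 b3.
have -> : p.+1%:Z = p%:Z + 1 by rewrite intS addrC.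
move=> eK; exists (B 0), (B 1).
have p_odd : odd p by rewrite ph /= oddM.
have [|K' eK'] := halve_mod_p2 (a := 4 * B 0) (b := (p%:Z + 1) * (3 * 'C(4 * m + 1, m)%:Z
  - 'C(12 * m + 3, 11 * m + 4)%:Z - 'C(12 * m + 3, 3 * m)%:Z - 'C(12 * m + 3, 5 * m + 1)%:Z))
  (K := K) p_odd.
  by rewrite eK !PoszM !PoszD; ring.
by exists K'; split; [exact: B_two_squares|exact: B_mod4|].
Qed.

End Inert.

Lemma character_sum_inert p m : prime p -> p = (8 * m + 3)%N ->
  exists A B k : int,
  [/\ p%:Z = A ^+ 2 + 2 * B ^+ 2, (A = 2 * m%:Z - 1 %[mod 4])%Z
    & 4 * A = (p%:Z + 1) * (3 * 'C(4 * m + 1, m)%:Z - 'C(12 * m + 3, 11 * m + 4)%:Z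
                 - 'C(12 * m + 3, 3 * m)%:Z
                 - 'C(12 * m + 3, 5 * m + 1)%:Z) + p%:Z ^+ 2 * k].
Proof.
move=> pp pm; have [m0|m0] := posnP m.
  (* For p = 3 the exponent h = 1 is too small for the general argument. *)
  by exists (-1), 1, 0; rewrite pm m0.
have [F chp cardF] := pPrimePowerField pp (isT : (0 < 2)%N).
have [g gP] := finField_primitive_root F.
have p21 : (1 < p ^ 2)%N by rewrite (ltn_exp2l 0) ?prime_gt1.
pose R : comNzRingType := gauss 'Z_(p ^ 2).
have hR (z : int) : z%:~R = 0 :> R -> (p%:Z ^+ 2 %| z)%Z.
  rewrite gauss_intr => -[/(intr_Zp_eq0 p21)].
  by rewrite (_ : p%:Z ^+ 2 = (p ^ 2)%N%:Z) ?PoszM ?expr2.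
have p2 : p%:R ^+ 2 = 0 :> R by rewrite -natrX gauss_natr pchar_Zp.
exact: (inert_character_sum pp pm m0 chp cardF gP (gauss_i_sqr _) p2 hR).
Qed.

(** * The congruence *)
Lemma signr_add_even m j : (-1) ^+ (m + 2 * j) = (-1) ^+ m :> int.
Proof. by rewrite exprD (exprM _ 2 j) sqrrN !expr1n mulr1. Qed.

Lemma sign_mod4 (A c : int) m : A ^+ 2 = c ^+ 2 ->
  (c = 1 %[mod 4])%Z -> (A = 2 * m%:Z - 1 %[mod 4])%Z -> A = (-1) ^+ m.+1 * c.
Proof.
move=> /eqP; rewrite eqf_sqr => Ac c1 A1.
rewrite exprS -signr_odd; case: (boolP (odd m)) => om /=; rewrite ?expr1 ?expr0;
  case/orP: Ac => /eqP eA; lia.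
Qed.

(** The common end of both cases: sg (1 + sg p) is the number of roots of unity
    summed over, namely p - 1 for sg = -1 and p + 1 for sg = 1. *)
Lemma eqmod_p2_of_root p (S : rat) (A c sg k : int) (C X Y Z s : nat) :
    prime p -> (2 < p)%N -> sg ^+ 2 = 1 ->
    4 * A = sg * (1 + sg * p%:Z) * (3 * C%:Z - X%:Z - Y%:Z - p%:Z * Z%:Z) + p%:Z ^+ 2 * k ->
    (p %| Z * C + 2)%N ->
    (let D := 3%:R * C%:R - X%:R - Y%:R in
     cong p 2 (2%:R * S) ((1 + sg%:~R * p%:R) * D) /\ cong p 1 D (2%:R * C%:R)) ->
    sg * A = (-1) ^+ s * c ->
  eqmod_p2 p S ((-1) ^+ s * (2%:R * c%:~R - p%:R / (2%:R * c%:~R))).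
Proof.
move=> pp p2 sg2 sumE /dvdnP[t et] [] eS eD AE.
set D : rat := 3%:R * C%:R - X%:R - Y%:R in eS eD.
pose A' : rat := (sg * A)%:~R.
have AZ : A' \in p_integral p by apply: rpred_int.
have DZ : D \in p_integral p by rewrite /D; p_integral_tac.
have eA : cong p 2 (4%:R * A') ((1 + sg%:~R * p%:R) * (D - p%:R * Z%:R)).
  exists (sg * k)%:~R; first by apply: rpred_int.
  have e : 4 * (sg * A) = (1 + sg * p%:Z) * (3 * C%:Z - X%:Z - Y%:Z - p%:Z * Z%:Z)
                      + p%:Z ^+ 2 * (sg * k).
    have -> : 4 * (sg * A) = sg * (4 * A) by ring.
    by rewrite sumE -[in RHS](mul1r (1 + _)) -sg2; ring.
  have := congr1 (fun z : int => z%:~R : rat) e; rewrite /A' => {}e.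
  rewrite /D -[4%:R * _]/((4 : int)%:~R * _) -intrM e.
  by rewrite !(intrD, intrM, mulrNz, rmorphXn) /= -!pmulrn; ring.
have eZ : cong p 1 (Z%:R * C%:R) (- 2%:R).
  exists t%:R; first exact: p_integral_nat.
  by rewrite expr1 -(natrM _ p t) (mulnC p) -et (natrD _ (Z * C)) natrM; ring.
have sub : {subset [:: A'; C%:R; D; Z%:R; sg%:~R] <= p_integral p}.
  move=> x; rewrite !in_cons in_nil orbF => /orP[/eqP->//|].
  case/orP=> [/eqP->|]; first exact: p_integral_nat.
  case/orP=> [/eqP->//|]/orP[]/eqP->; [exact: p_integral_nat|exact: rpred_int].
have [vZ [z zZ eS']] := unit_root_mod_p2 pp p2 sub eS eA eD eZ.
have p0 : p%:R != 0 :> rat by rewrite pnatr_eq0 -lt0n prime_gt0.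
have -> : (-1) ^+ s * (2%:R * c%:~R - p%:R / (2%:R * c%:~R)) =
          2%:R * A' - p%:R / (2%:R * A') :> rat.
  rewrite /A' AE intrM rmorphXn rmorphN1 -signr_odd.
  by case: (odd s); rewrite ?expr1 ?expr0 ?mul1r // !mulN1r mulrN invrN mulrN -opprD.
have wZ : 2%:R * A' - p%:R / (2%:R * A') \in p_integral p.
  by p_integral_tac.
split=> //.
  by rewrite eS' -natrX; p_integral_tac.
by rewrite eS' addrAC subrr add0r mulrC mulKf // expf_neq0.
Qed.

Theorem theorem2p5 (p : nat) (c d : int) (p_prime : prime p)
    (p_mod8 : (p = 1 %[mod 8])%N \/ (p = 3 %[mod 8])%N)
    (p_repr : p%:Z = c ^+ 2 + 2 * d ^+ 2)
    (c_mod4 : (c = 1 %[mod 4])%Z) :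
  eqmod_p2 p
    (\sum_(0 <= k < p)
       ('C(2 * k, k) * 'C(4 * k, 2 * k))%N%:R / 128%:R ^+ k)
    ((-1) ^+ (p %/ 8 + (p - 1) %/ 2)%N
       * (2%:R * c%:~R - p%:R / (2%:R * c%:~R))).
Proof.
set m := (p %/ 8)%N; have p2 : (2 < p)%N by have := prime_gt1 p_prime; case: p_mod8; lia.
case: p_mod8 => p_mod8.
  have pm : p = (8 * m).+1 by rewrite /m; lia.
  have [ph mh h2] : [/\ p = (2 * (4 * m)).+1, (m <= 4 * m)%N & ((p - 1) %/ 2 = 2 * (2 * m))%N].
    by split; lia.
  have [i1 i2] : (4 * m + p.-1 = 12 * m)%N /\ (4 * m + m = 5 * m)%N by lia.
  have [A [B [k [rep mod4 sumE]]]] := character_sum_split p_prime pm.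
  have [Z binE ZC] := bin_top_Fp p_prime ph mh; rewrite i1 i2 in binE.
  have AE := sign_mod4 (two_square_unique p_prime rep p_repr) c_mod4 mod4.
  have eA : 4 * A = -1 * (1 + -1 * p%:Z) * (3 * 'C(4 * m, m)%:Z - 'C(12 * m, m)%:Z
                 - 'C(12 * m, 3 * m)%:Z - p%:Z * Z%:Z) + p%:Z ^+ 2 * k.
    by rewrite sumE binE PoszM; ring.
  have eS := truncated_sum_split p_prime pm (erefl _) (erefl _).
  have AE' : -1 * A = (-1) ^+ (m + (p - 1) %/ 2) * c.
    by rewrite h2 signr_add_even AE exprS mulN1r mulN1r !mulNr opprK.
  exact: (eqmod_p2_of_root p_prime p2 (sqrrN 1) eA ZC eS AE').
have pm : p = (8 * m + 3)%N by rewrite /m; lia.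
have [ph mh h2] : [/\ p = (2 * (4 * m + 1)).+1, (m <= 4 * m + 1)%N
                   & ((p - 1) %/ 2 = 1 + 2 * (2 * m))%N].
  by split; lia.
have [i1 i2] : (4 * m + 1 + p.-1 = 12 * m + 3)%N /\ (4 * m + 1 + m = 5 * m + 1)%N by lia.
have [A [B [k [rep mod4 sumE]]]] := character_sum_inert p_prime pm.
have [Z binE ZC] := bin_top_Fp p_prime ph mh; rewrite i1 i2 in binE.
have AE := sign_mod4 (two_square_unique p_prime rep p_repr) c_mod4 mod4.
have eA : 4 * A = 1 * (1 + 1 * p%:Z) * (3 * 'C(4 * m + 1, m)%:Z - 'C(12 * m + 3, 11 * m + 4)%:Z
                 - 'C(12 * m + 3, 3 * m)%:Z - p%:Z * Z%:Z) + p%:Z ^+ 2 * k.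
  by rewrite sumE binE PoszM; ring.
have eS := truncated_sum_inert p_prime pm (erefl _) (erefl _).
have AE' : 1 * A = (-1) ^+ (m + (p - 1) %/ 2) * c.
  by rewrite h2 addnA signr_add_even addn1 mul1r.
exact: (eqmod_p2_of_root p_prime p2 (expr1n _ 2) eA ZC eS AE').
Qed.
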